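(* Let $X$ be a Banach space, $n\ge2$ an integer, $\Omega_1,\ldots,\Omega_n\subset X$ closed sets, and $\bar x\in\bigcap_{i=1}^n\Omega_i$. Assume that either $X$ is Asplund, or $\Omega_1,\ldots,\Omega_n$ are convex. Suppose that the collection $\{\Omega_1,\ldots,\Omega_n\}$ is $\mathcal F_A$-extremal at $\bar x$. Then, for each $\varepsilon>0$, there exist points $x_i\in\Omega_i\cap B_\varepsilon(\bar x)$ and $x_i^*\in X^*$ $(i=1,\ldots,n)$ satisfying $$\sum_{i=1}^n\operatorname{dist}_{N_{\Omega_i}(x_i)}(x_i^* )<\varepsilon,\qquad\sum_{i=1}^nx_i^*=0,\qquad\sum_{i=1}^{n-1}\|x_i^*\|=1.$$ Moreover, for each $\tau\in(0,1)$, the points $x_i$ and $x_i^*$ $(i=1,\ldots,n)$ can be chosen so that, in addition, $$\sum_{i=1}^{n-1}\langle x_i^*,x_n-x_i+a_i\rangle>\tau\max_{1\le i\le n-1}\|x_n-x_i+a_i\|,$$ where $a_1,\ldots,a_{n-1}\in X$ are some vectors with $\max_{1\le i\le n-1}\|a_i\|<\varepsilon$ for which there is a number $\rho>0$ such that $\bigcap_{i=1}^{n-1}(\Omega_i+\rho\mathbb B-a_i)\cap(\Omega_n+\rho\mathbb B)=\varnothing$.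
   Context: $B_\delta(x)$ is the open ball, $\mathbb B$ the open unit ball of $X$, $\operatorname{dist}_\Omega(x)=\inf_{u\in\Omega}\|x-u\|$. $\mathcal F_A$ is the family of all functions $f_a\colon X^n\to\mathbb R$, $a=(a_1,\ldots,a_{n-1})\in X^{n-1}$, given by $f_a(x_1,\ldots,x_n):=\max_{1\le i\le n-1}\|x_i-a_i\|$. For a nonempty family $\mathcal F$ of nonnegative lower semicontinuous functions $f\colon X^n\to\mathbb R\cup\{+\infty\}$, the collection $\{\Omega_1,\ldots,\Omega_n\}$ is $\mathcal F$-extremal at $\bar x$ if, for each $\varepsilon>0$, there exist $f\in\mathcal F$ and $\rho>0$ such that $f(0,\ldots,0,\bar x)<\varepsilon$ and $f(x_1-x_n,\ldots,x_{n-1}-x_n,x_n)>0$ for all $x_i\in\Omega_i+\rho\mathbb B$ $(i=1,\ldots,n)$. Fréchet normal cone: for $\bar x\in\Omega$, $N_\Omega(\bar x)=\{x^*\in X^*\mid\limsup_{x\to\bar x,\,x\in\Omega\setminus\{\bar x\}}\langle x^*,x-\bar x\rangle/\|x-\bar x\|\le0\}$. A Banach space is Asplund if every continuous convex function on an open convex set is Fréchet differentiable on a dense subset. *)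

(* Defs.v *)
From HB Require Import structures.
From mathcomp Require Import all_boot all_order all_algebra.
From mathcomp Require Import all_classical all_reals all_analysis.

Set Implicit Arguments.
Unset Strict Implicit.
Unset Printing Implicit Defensive.

Import Order.TTheory GRing.Theory Num.Theory.
Import numFieldNormedType.Exports.

Local Open Scope classical_set_scope.
Local Open Scope ring_scope.

(* A collection of n = m + 1 objects (n >= 2 iff 0 < m) is indexed by 'I_m.+1:
   the last index n is [ord_max], and the indices 1, ..., n - 1 are the
   [below i] for i : 'I_m. *)
Definition below (m : nat) (i : 'I_m) : 'I_m.+1 := widen_ord (leqnSn m) i.

Section Asplund.
Variables (R : realType) (X : completeNormedModType R).

(* Only the values of f on the open set D matter; [differentiable] is Frechet
   differentiability. *)
Definition Asplund : Prop :=
  forall (D : set X) (f : X -> R^o),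
    open D -> convex_set (D : set (convex_lmodType X)) ->
    {in D, continuous f} -> convex_function D f ->
    D `<=` closure [set x | D x /\ differentiable f x].

End Asplund.

Section Dual.
Variables (R : realType) (X : normedModType R).

(* X^* is handled as a set of functions; sums and differences of functionals
   are taken pointwise, in the zmodType of functions X -> R^o. *)
Definition dual_space : set (X -> R^o) := [set f | linear f /\ continuous f].

Definition dual_norm (f : X -> R^o) : R :=
  sup [set `|f x| | x in [set x : X | `|x| <= 1]].

Definition dual_dist (N : set (X -> R^o)) (f : X -> R^o) : R :=
  inf [set dual_norm (f - g) | g in N].

(* Meaningful for xbar \in Omega.  If xbar is isolated in Omega, the limsup is
   -oo and the cone is the whole dual. *)
Definition Frechet_normal_cone (Omega : set X) (xbar : X) : set (X -> R^o) :=
  [set f | dual_space f /\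
    (limf_esup (fun x : X => (f (x - xbar) / `|x - xbar|)%:E)
               (within (Omega `\ xbar) (nbhs xbar)) <= 0)%E].

Definition enlarge (Omega : set X) (rho : R) : set X :=
  [set u + rho *: b | u in Omega & b in ball (0 : X) 1].

End Dual.

Section Extremality.
Variables (R : realType) (X : normedModType R) (m : nat).

(* The base value 0 does not change the maximum when 0 < m, norms being
   nonnegative. *)
Definition maxnorm (a : 'I_m -> X) : R := \big[Num.max/0]_(i < m) `|a i|.

Definition admissible_family (F : set (('I_m.+1 -> X) -> \bar R)) : Prop :=
  F !=set0 /\
  forall f, F f ->
    (forall x, (0 <= f x)%E) /\
    lower_semicontinuous (f : prod_topology (fun=> X) -> \bar R).

(* Intended for admissible families. *)
Definition extremal (F : set (('I_m.+1 -> X) -> \bar R))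
    (Omega : 'I_m.+1 -> set X) (xbar : X) : Prop :=
  forall eps : R, 0 < eps ->
    exists f : ('I_m.+1 -> X) -> \bar R, exists rho : R,
    [/\ F f,
        0 < rho,
        (f (fun i => if i == ord_max then xbar else 0)%R < eps%:E)%E &
        forall x : 'I_m.+1 -> X, (forall i, enlarge (Omega i) rho (x i)) ->
          (0 < f (fun i => if i == ord_max then x ord_max
                           else x i - x ord_max)%R)%E].

Definition FA_fun (a : 'I_m -> X) (x : 'I_m.+1 -> X) : \bar R :=
  (maxnorm (fun i => x (below i) - a i))%:E.

Definition FA : set (('I_m.+1 -> X) -> \bar R) := range FA_fun.

Lemma admissible_FA : admissible_family FA.
Proof.
split; first by exists (FA_fun (fun=> 0)); exists (fun=> 0).
move=> _ [a _ <-]; split=> [x|x r].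
  rewrite lee_fin; exact: bigmax_ge_id.
rewrite lte_fin => /bigmax_gtP[r0|[i _ ri]].
  exists setT; first exact: filterT.
  by move=> y _; rewrite lte_fin; apply/bigmax_gtP; left.
have cn : continuous (fun z : X => `|z - a i|).
  by move=> z; apply: cvg_norm; apply: cvgB; [exact: cvg_id|exact: cvg_cst].
exists ((fun y : 'I_m.+1 -> X => y (below i)) @^-1` [set z | r < `|z - a i|]).
  apply: (@proj_continuous _ (fun=> X) (below i) x).
  by apply: (cn (x (below i)) [set t | r < t]); exact: lt_nbhsr.
by move=> y /= ry; rewrite lte_fin; apply/bigmax_gtP; right; exists i.
Qed.

End Extremality.

Arguments FA {R} X m.

Section Separation.
Variables (R : realType) (X : normedModType R) (m : nat).

Definition fuzzy_separation (Omega : 'I_m.+1 -> set X) (xbar : X) (eps : R)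
    (x : 'I_m.+1 -> X) (xs : 'I_m.+1 -> X -> R^o) : Prop :=
  [/\ forall i, Omega i (x i) /\ ball xbar eps (x i),
      forall i, dual_space (xs i),
      \sum_(i < m.+1)
         dual_dist (Frechet_normal_cone (Omega i) (x i)) (xs i) < eps,
      \sum_(i < m.+1) xs i = 0 &
      \sum_(i < m) dual_norm (xs (below i)) = 1].

End Separation.

(* Main.v *)
(** Extremality gives shifts a and rho > 0 such that the gap function
    phi(u) = max_i |u_n - u_i + a_i| is at least rho on the product of the
    sets and nearly minimal at (xbar, ..., xbar).  By a sandwich form of the
    Hahn-Banach theorem, the functionals sought exist at u as soon as no
    finite combination of secant vectors w - u_i (w in Omega_i near u_i)
    violates one inequality; such a violation is an open condition on u.
    If the sets are convex, this criterion holds at an Ekeland point of phi.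
    If X is Asplund, openness makes it possible to close a countable set under
    witnesses of violation, so that the criterion need only be checked along a
    separable subspace Y.  The restrictions to Y of the functionals of X form a
    separable space: otherwise a minimal sublinear functional on X dominating a
    suitable one on Y would be nowhere Frechet differentiable.  Hence the
    conjugate of a strictly convex penalty is an approximation of the norm of
    X^n that is Frechet smooth along Y^n.  Minimizing the smoothed phi plus a
    series of smooth perturbations over the product of the sets Omega_i
    intersected with Y yields a point where the derivative of the smooth
    function provides the functionals. *)

Require Import Defs.
From HB Require Import structures.
From mathcomp Require Import all_boot all_order all_algebra.
From mathcomp Require Import all_classical all_reals all_analysis.
From mathcomp Require Import ring lra.

Set Implicit Arguments.
Unset Strict Implicit.
Unset Printing Implicit Defensive.

Import Order.TTheory GRing.Theory Num.Theory.
Import numFieldNormedType.Exports.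

Local Open Scope classical_set_scope.
Local Open Scope ring_scope.

(** * Sublinear functionals and the sandwich theorem *)

Section Sublinear.
Variables (R : realType) (V : lmodType R).
Implicit Types (q f : V -> R) (G : V -> R -> Prop).

(** A Frechet normal condition involves every accuracy and every nearby point of [Omega i], so a
    functional tested only along Y says nothing about the rest of X. Dualizing helps: once a radius
    is fixed for each accuracy 1/(j+1), the absence of a functional on X is witnessed by finitely
    many points, a finite list of radii and one strict inequality. Such lists form a countable type,
    and a witness survives a small move of u. Since a witness sees only finitely many accuracies,
    the functionals that rule out different witnesses may differ. The Asplund property is used on X
    alone; its passage to Y is replaced by the minimal sublinear functional, which lives on X but is
    constrained only on Y. A single number al measures all errors: the sum of the functionals has
    norm at most al, the first n - 1 norms add up to at most 1 + al, and the pairing with the gap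
    vector loses a fraction 2 al of its size. The lower bound rho makes the absolute smoothing error
    a fraction of the gap and keeps the gap nonzero for the final normalization. *)

Definition sublinear q :=
  (forall x y, q (x + y) <= q x + q y) /\
  (forall t x, 0 <= t -> q (t *: x) = t * q x).

Definition linear_form f :=
  (forall x y, f (x + y) = f x + f y) /\ (forall a x, f (a *: x) = a * f x).

Lemma linear_form0 f : linear_form f -> f 0 = 0.
Proof. by move=> [_ fZ]; rewrite -(scale0r 0) fZ mul0r. Qed.

Lemma linear_formN f x : linear_form f -> f (- x) = - f x.
Proof. by move=> [_ fZ]; rewrite -scaleN1r fZ mulN1r. Qed.

Lemma linear_formB f x y : linear_form f -> f (x - y) = f x - f y.
Proof. by move=> lf; rewrite lf.1 linear_formN. Qed.

Lemma sublinear0 q : sublinear q -> q 0 = 0.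
Proof. by move=> [_ qZ]; rewrite -(scale0r 0) qZ // mul0r. Qed.

Lemma sublinear_ge q x : sublinear q -> - q (- x) <= q x.
Proof. by move=> sq; have := sq.1 x (- x); rewrite subrr sublinear0 //; lra. Qed.

Lemma sublinear_linear_form q : sublinear q ->
  (forall x y, q x + q y <= q (x + y)) -> linear_form q.
Proof.
move=> sq sup; have qD x y : q (x + y) = q x + q y.
  by apply/eqP; rewrite eq_le sup sq.1.
have qN x : q (- x) = - q x.
  by have := qD x (- x); rewrite subrr sublinear0 //; lra.
split=> // a x; have [a0|/ltW a0] := leP 0 a; first exact: sq.2.
by have := sq.2 (- a) x; rewrite scaleNr qN oppr_ge0 => /(_ a0); lra.
Qed.

(** A cone in V x R; a pair (v, r) of it is read as the constraint [f v <= r] on a linear form f. *)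
Definition convex_cone G :=
  [/\ G 0 0, forall v w r s, G v r -> G w s -> G (v + w) (r + s) &
      forall t v r, 0 <= t -> G v r -> G (t *: v) (t * r)].

(** When the cone is compatible with q, this is the largest sublinear functional below q that meets
    all constraints of G. *)
Definition infconv q G (h : V) : R :=
  inf [set s | exists v r, G v r /\ s = q (h - v) + r].

Section InfConv.
Variables (q : V -> R) (G : V -> R -> Prop).
Hypotheses (sq : sublinear q) (cG : convex_cone G).
Hypothesis G0 : forall v r, G v r -> 0 <= q (- v) + r.

Let infconv_lb h s : (exists v r, G v r /\ s = q (h - v) + r) -> - q (- h) <= s.
Proof.
move=> [v [r [Gvr ->]]]; have := G0 Gvr; have := sq.1 (h - v) (- h).
by rewrite addrAC subrr add0r; lra.
Qed.

Lemma infconv_le h v r : G v r -> infconv q G h <= q (h - v) + r.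
Proof.
move=> Gvr; apply: ge_inf; last by exists v, r.
by exists (- q (- h)) => s /infconv_lb.
Qed.

Lemma infconv_ge h c : (forall v r, G v r -> c <= q (h - v) + r) ->
  c <= infconv q G h.
Proof.
move=> H; apply: lb_le_inf; last by move=> s [v [r [Gvr ->]]]; exact: H.
by exists (q (h - 0) + 0), 0, 0; split=> //; case: cG.
Qed.

Lemma infconv_le_self h : infconv q G h <= q h.
Proof.
by have [G00 _ _] := cG; have := infconv_le h G00; rewrite subr0 addr0.
Qed.

Lemma sublinear_infconv : sublinear (infconv q G).
Proof.
have [G00 GD GZ] := cG.
have sD x y : infconv q G (x + y) <= infconv q G x + infconv q G y.
  rewrite -lerBlDr; apply: infconv_ge => v r Gv.
  suff H : infconv q G (x + y) - (q (x - v) + r) <= infconv q G y by move: H; lra.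
  apply: infconv_ge => w s Gw.
  have := infconv_le (x + y) (GD _ _ _ _ Gv Gw).
  rewrite opprD addrACA; have := sq.1 (x - v) (y - w); lra.
have i0 : infconv q G 0 = 0.
  apply/le_anti/andP; split; first by rewrite -(sublinear0 sq) infconv_le_self.
  by apply: infconv_ge => v r /G0; rewrite sub0r.
have sZ t x : 0 < t -> infconv q G (t *: x) <= t * infconv q G x.
  move=> t0; rewrite -ler_pdivrMl //; apply: infconv_ge => v r Gv.
  rewrite ler_pdivrMl // mulrDr -(sq.2 _ _ (ltW t0)) scalerBr.
  by apply: infconv_le; apply: GZ Gv; exact: ltW.
split=> // t x; rewrite le_eqVlt => /predU1P[<-|t0].
  by rewrite scale0r mul0r i0.
apply/le_anti; rewrite sZ //=.
have := sZ t^-1 (t *: x); rewrite invr_gt0 scalerA mulVf ?gt_eqF // scale1r.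
by move/(_ t0); rewrite ler_pdivlMl.
Qed.

End InfConv.

(** The lower bound p is void for the sandwich theorem, where Y is empty, and is the support
    function of a set of functionals in the dentability lemma. *)
Lemma sublinear_min q0 (Y : set V) (p : V -> R) :
  sublinear q0 -> (forall y, Y y -> p y <= q0 y) ->
  exists q, [/\ sublinear q, forall x, q x <= q0 x,
    forall y, Y y -> p y <= q y &
    forall q', sublinear q' -> (forall x, q' x <= q x) ->
      (forall y, Y y -> p y <= q' y) -> q' = q].
Proof.
move=> sq0 pq0.
pose T := {q | [/\ sublinear q, forall x, q x <= q0 x &
                  forall y, Y y -> p y <= q y]}.
(* The order is reversed: maximal for [Rel] means minimal as a functional. *)
pose Rel (s t : T) := `[< forall x, sval t x <= sval s x >].
have [] := @Zorn T Rel.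
- by move=> t; apply/asboolP.
- move=> r s t /asboolP rs /asboolP st; apply/asboolP => x.
  exact: le_trans (st x) (rs x).
- move=> [s ps] [t pt] /asboolP /= st /asboolP /= ts; apply/eq_exist.
  by apply/funext => x; apply/le_anti; rewrite st ts.
- move=> A totA.
  (* The empty chain is separate, because the pointwise infimum over it would be the default value 0
     of [inf]. *)
  have [[t0 At0]|A0] := pselect (exists t, A t); last first.
    have q0T : [/\ sublinear q0, forall x, q0 x <= q0 x &
      forall y, Y y -> p y <= q0 y] by [].
    by exists (exist _ q0 q0T) => s As; case: A0; exists s.
  pose E x := [set sval t x | t in A].
  pose q x := inf (E x).
  have lbE x : lbound (E x) (- q0 (- x)).
    move=> _ [t At <-]; case: (svalP t) => st tq _.
    by have := sublinear_ge x st; have := tq (- x); lra.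
  have qle x t : A t -> q x <= sval t x.
    by move=> At; apply: ge_inf; [exists (- q0 (- x))|exists t].
  have qge x c : (forall t, A t -> c <= sval t x) -> c <= q x.
    move=> H; apply: lb_le_inf; first by exists (sval t0 x), t0.
    by move=> _ [t At <-]; exact: H.
  have sq : sublinear q.
    split=> [x y|t x t_ge0].
      rewrite -lerBlDr; apply: (qge) => s As.
      suff H : q (x + y) - sval s x <= q y by move: H; lra.
      apply: (qge) => t At; rewrite lerBlDr.
      case: (svalP s) (svalP t) => ss _ _ [st _ _].
      case: (totA s t As At) => /asboolP H.
        have := qle (x + y) _ At; have := st.1 x y; have := H x; lra.
      have := qle (x + y) _ As; have := ss.1 x y; have := H y; lra.
    move: t_ge0; rewrite le_eqVlt => /predU1P[<-|t_gt0].
      rewrite scale0r mul0r; apply/le_anti/andP; split.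
        have := qle 0 _ At0; case: (svalP t0) => st _ _.
        by rewrite (sublinear0 st).
      by apply: (qge) => s _; case: (svalP s) => ss _ _; rewrite (sublinear0 ss).
    apply/le_anti/andP; split.
      rewrite -ler_pdivrMl //; apply: (qge) => s As; rewrite ler_pdivrMl //.
      case: (svalP s) => ss _ _; rewrite -(ss.2 _ _ (ltW t_gt0)); exact: qle.
    apply: (qge) => s As; case: (svalP s) => ss _ _; rewrite (ss.2 _ _ (ltW t_gt0)).
    by rewrite ler_pM2l //; exact: qle.
  have qT : [/\ sublinear q, forall x, q x <= q0 x &
      forall y, Y y -> p y <= q y].
    split=> // [x|y Yy].
      by apply: le_trans (qle x _ At0) _; case: (svalP t0).
    by apply: (qge) => t At; case: (svalP t) => _ _; exact.
  by exists (exist _ q qT) => s As; apply/asboolP => x; exact: qle.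
move=> [q [sq qq0 pq]] /= max; exists q; split=> // q' sq' q'q pq'.
have q'T : [/\ sublinear q', forall x, q' x <= q0 x &
      forall y, Y y -> p y <= q' y].
  by split=> // x; exact: le_trans (q'q x) (qq0 x).
have [] // : exist _ q' q'T = exist _ q (And3 sq qq0 pq) :> T.
by apply: max; apply/asboolP.
Qed.

(** Sublinear functionals that are minimal for the pointwise order are linear, and one below
    [infconv q G] meets both bounds. Compatibility is also necessary, as 0 = f (-v) + f v. *)
Theorem sandwich q G : sublinear q -> convex_cone G ->
  (forall v r, G v r -> 0 <= q (- v) + r) ->
  exists f, [/\ linear_form f, forall x, f x <= q x & forall v r, G v r -> f v <= r].
Proof.
move=> sq cG G0; have sqG := sublinear_infconv sq cG G0.
have [|f [sf fq _ minf]] := @sublinear_min _ set0 (fun=> 0) sqG.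
  by [].
exists f; split; last 2 first.
- by move=> x; apply: le_trans (fq x) _; exact: infconv_le_self.
- move=> v r Gvr; apply: le_trans (fq v) _.
  have := infconv_le sq G0 v Gvr.
  by rewrite subrr (sublinear0 sq) add0r.
(* A minimal sublinear functional does not change under restriction to the
   functionals attaining it at x, which forces additivity. *)
apply: sublinear_linear_form => // h x.
pose H v r := exists2 t, 0 <= t & v = - (t *: x) /\ r = - (t * f x).
have cH : convex_cone H.
  split; first by exists 0; rewrite ?scale0r ?mul0r ?oppr0.
  - move=> v w r s [t t0 [-> ->]] [u u0 [-> ->]]; exists (t + u).
      exact: addr_ge0.
    by rewrite scalerDl mulrDl !opprD.
  - move=> t v r t0 [u u0 [-> ->]]; exists (t * u); first exact: mulr_ge0.
    by rewrite scalerN scalerA mulrN mulrA.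
have H0 v r : H v r -> 0 <= f (- v) + r.
  by move=> [t t0 [-> ->]]; rewrite opprK sf.2 // subrr.
have fE := minf _ (sublinear_infconv sf cH H0) (infconv_le_self sf cH H0).
have /(infconv_le sf H0 h) : H (- x) (- f x).
  by exists 1 => //; rewrite scale1r mul1r.
by rewrite fE // opprK; lra.
Qed.

End Sublinear.

(** * Dentability of the dual of an Asplund space *)

Section Extension.
Variables (R : realType) (V : lmodType R).

Definition linear_subspace (W : set V) :=
  W 0 /\ forall (a : R) x y, W x -> W y -> W (a *: x + y).

Lemma linear_subspaceD (W : set V) x y : linear_subspace W -> W x -> W y -> W (x + y).
Proof. by move=> [_ sW] Wx Wy; rewrite -[x]scale1r; exact: sW. Qed.

Lemma linear_subspaceZ (W : set V) (a : R) x : linear_subspace W -> W x -> W (a *: x).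
Proof. by move=> [W0 sW] Wx; rewrite -[a *: x]addr0; exact: sW. Qed.

Lemma linear_subspaceN (W : set V) x : linear_subspace W -> W x -> W (- x).
Proof. by move=> sW Wx; rewrite -scaleN1r; exact: linear_subspaceZ. Qed.

Lemma linear_subspaceB (W : set V) x y : linear_subspace W -> W x -> W y -> W (x - y).
Proof. by move=> sW Wx Wy; apply: linear_subspaceD => //; exact: linear_subspaceN. Qed.

(** Hahn-Banach: the graph of g over W is a cone of constraints, and its symmetry turns the
    inequalities into equalities. *)
Lemma linear_form_extension (q g : V -> R) (W : set V) :
  sublinear q -> linear_subspace W ->
  (forall x y, W x -> W y -> g (x + y) = g x + g y) ->
  (forall a x, W x -> g (a *: x) = a * g x) ->
  (forall x, W x -> g x <= q x) ->
  exists f, [/\ linear_form f, forall x, f x <= q x & forall x, W x -> f x = g x].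
Proof.
move=> sq sW gD gZ gq.
have gN x : W x -> g (- x) = - g x.
  by move=> Wx; rewrite -scaleN1r gZ // mulN1r.
have [| |f [lf fq fg]] := @sandwich _ _ q (fun v r => W v /\ g v = r) sq.
- split; first by split; [exact: sW.1|have := gZ 0 0 sW.1; rewrite scale0r mul0r].
  + move=> v w r s [Wv <-] [Ww <-]; split; first exact: linear_subspaceD.
    exact: gD.
  + by move=> t v r _ [Wv <-]; split; [exact: linear_subspaceZ|exact: gZ].
- move=> v r [Wv <-]; have := gq _ (linear_subspaceN sW Wv); rewrite gN //; lra.
exists f; split=> // x Wx; apply/le_anti/andP; split; first exact: fg.
have := fg (- x) (- g x); rewrite (linear_formN _ lf) lerN2; apply.
by split; [exact: linear_subspaceN|exact: gN].
Qed.

End Extension.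

Section Dentability.
Variables (R : realType) (X : completeNormedModType R).
Implicit Types (q f : X -> R) (Y : set X) (A : set (X -> R)).

(** The closed unit ball of the dual; continuity follows from the bound by the norm. *)
Definition unit_form f := linear_form f /\ forall x, f x <= `|x|.

Lemma unit_form_normr f x : unit_form f -> `|f x| <= `|x|.
Proof.
move=> [lf fle]; rewrite ler_norml fle andbT.
by have := fle (- x); rewrite (linear_formN _ lf) normrN; lra.
Qed.

Lemma sublinear_norm : sublinear (fun x : X => `|x|).
Proof.
by split=> [x y|t x t0]; [exact: ler_normD|rewrite normrZ ger0_norm].
Qed.

(** Such a q is convex and 1-Lipschitz, so the Asplund property applies. Only the upper estimate is
    kept, as it will be compared with linear forms below q. *)
Lemma sublinear_Frechet q : Asplund X -> sublinear q ->
  (forall x, q x <= `|x|) ->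
  exists x (L : X -> R), linear_form L /\ forall e : R, 0 < e ->
    exists2 d : R, 0 < d &
      forall h, `|h| <= d -> q (x + h) <= q x + L h + e * `|h|.
Proof.
move=> aX sq qle.
have qB x y : q x - q y <= `|x - y|.
  by have := sq.1 (x - y) y; have := qle (x - y); rewrite subrK; lra.
have cq : continuous (q : X -> R^o).
  move=> x; apply/cvgrPdist_lt => e e0; near=> y.
  apply: (@le_lt_trans _ _ `|x - y|).
    by rewrite ler_norml qB andbT; have := qB y x; rewrite distrC; lra.
  by near: y; apply: cvgr_dist_lt.
have convq : convex_function setT (q : X -> R^o).
  move=> t x y _ _; rewrite convRE.
  apply: le_trans (sq.1 _ _) _.
  have t0 : 0 <= (t%:num : R) by [].
  have t1 : 0 <= unstable.onem (t%:num : R) by rewrite /unstable.onem subr_ge0.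
  by apply: lerD; rewrite le_eqVlt; apply/predU1P; left; exact: sq.2.
have [x [_ dx]] : [set x | setT x /\ differentiable (q : X -> R^o) x] !=set0.
  have cT : convex_set (setT : set (convex_lmodType X)).
    by move=> x y l _ _; rewrite in_setT.
  have [|x [Dx _]] := aX setT q openT cT (in1W cq) convq 0 I setT.
    exact: filterT.
  by exists x.
have [_ Lx] := (diff_locallyxP x (q : X -> R^o)).1 dx.
exists x, ('d (q : X -> R^o) x); split.
  by split=> [u v|a u]; [exact: linearD|exact: linearZ].
move=> e e0.
have /eqaddoP/(_ _ e0)/nbhs_ballP[d /= d0 Hd] :
    (fun h => q (h + x) : R^o) = (fun h => q x + 'd (q : X -> R^o) x h)
      +o_ (nbhs (0 : X)) id by apply/funext.
exists (d / 2); first by rewrite divr_gt0.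
move=> h hd; have /Hd /= : ball (0:X) d h.
  by rewrite -ball_normE /= sub0r normrN; apply: le_lt_trans hd _; lra.
rewrite !fctE addrC => /ler_normlP[_]; rewrite [x + h]addrC; lra.
Unshelve. all: by end_near.
Qed.

(** A has a slice, cut by a point of Y, whose diameter is at most e for the norm of restrictions to
    Y. Differentiability supplies a small slice at a point x of X only; minimality of q transports
    it to a point y of Y. *)
Lemma dentable Y A e : Asplund X -> linear_subspace Y -> A !=set0 ->
  (forall a, A a -> unit_form a) -> 0 < e ->
  exists y r, [/\ Y y, exists2 a, A a & r < a y &
    forall a b, A a -> A b -> r < a y -> r < b y ->
      forall z, Y z -> `|a z - b z| <= e * `|z|].
Proof.
move=> aX sY [a0 Aa0] Ac e_gt0.
pose p y := sup [set a y | a in A].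
have ale a y : A a -> a y <= p y.
  move=> Aa; apply: ub_le_sup; last by exists a.
  by exists `|y| => _ [b Ab <-]; exact: (Ac _ Ab).2.
have [|q [sq qle pq qmin]] := @sublinear_min _ _ _ Y p sublinear_norm.
  move=> y _; apply: ge_sup; first by exists (a0 y), a0.
  by move=> _ [b Ab <-]; exact: (Ac _ Ab).2.
(* Members of A are below q only on Y, so they are replaced by forms below q that agree with them
   there. *)
have ext a : A a -> exists f, [/\ linear_form f, forall x, f x <= q x &
    forall y, Y y -> f y = a y].
  move=> Aa; have [la _] := Ac _ Aa; apply: linear_form_extension => //.
  - by move=> *; exact: la.1.
  - by move=> *; exact: la.2.
  - by move=> y Yy; apply: le_trans (ale _ y Aa) _; exact: pq.
have [x [L [lL Lx]]] := sublinear_Frechet aX sq qle.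
have [|d d0 Ld] := Lx (e / 4); first by rewrite divr_gt0.
pose eta := e / 4 * d.
have eta0 : 0 < eta by rewrite mulr_gt0 // divr_gt0.
(* Smulyan's test: forms below q that nearly attain q at a point of differentiability are close to
   the derivative. The step t scales z to the length d where the estimate is tightest. *)
have small f : linear_form f -> (forall z, f z <= q z) -> q x - eta < f x ->
    forall z, f z - L z <= e / 2 * `|z|.
  move=> lf fq fx z; have [->|z0] := eqVneq z 0.
    by rewrite (linear_form0 lf) (linear_form0 lL) normr0; lra.
  have nz : 0 < `|z| by rewrite normr_gt0.
  pose t := d / `|z|; have t0 : 0 < t by rewrite divr_gt0.
  have tz : t * `|z| = d by rewrite mulfVK ?gt_eqF.
  have ntz : `|t *: z| = d by rewrite normrZ gtr0_norm.
  have := Ld (t *: z); rewrite ntz lexx => /(_ isT).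
  have := fq (x + t *: z); rewrite lf.1 lf.2 lL.2 -/eta => h1 h2.
  have : t * (f z - L z) <= 2 * eta by rewrite mulrBr; lra.
  rewrite -ler_pdivlMl // => /le_trans; apply.
  rewrite /eta -tz ler_pdivrMl //; lra.
have close a b f g : A a -> A b -> linear_form f -> (forall z, f z <= q z) ->
    (forall y, Y y -> f y = a y) -> q x - eta < f x ->
    linear_form g -> (forall z, g z <= q z) ->
    (forall y, Y y -> g y = b y) -> q x - eta < g x ->
    forall z, Y z -> `|a z - b z| <= e * `|z|.
  move=> Aa Ab lf fq fa fx lg gq gb gx z Yz.
  rewrite -fa // -gb //.
  have h1 := small _ lf fq fx z; have h2 := small _ lg gq gx z.
  have h3 := small _ lf fq fx (- z); have h4 := small _ lg gq gx (- z).
  move: h3 h4; rewrite !normrN !(linear_formN _ lf, linear_formN _ lg,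
    linear_formN _ lL) => h3 h4.
  by rewrite ler_norml; apply/andP; split; lra.
(* If q is almost linear along x, every form below q lies in the slice at x, so the whole of A is
   small and y = 0 will do. Otherwise the constraint [f x <= q x - eta] is compatible with q. *)
have [le_eta|lt_eta] := leP eta (q x + q (- x)); last first.
  exists 0, (-1); split; first exact: sY.1.
    by exists a0 => //; rewrite (linear_form0 (Ac _ Aa0).1); lra.
  move=> a b Aa Ab _ _; have [f [lf fq fa]] := ext a Aa.
  have [g [lg gq gb]] := ext b Ab; apply: (close a b f g) => //.
    by have := fq (- x); rewrite (linear_formN _ lf); lra.
  by have := gq (- x); rewrite (linear_formN _ lg); lra.
pose G v r := exists2 t, 0 <= t & v = t *: x /\ r = t * (q x - eta).
have cG : convex_cone G.
  split; first by exists 0; rewrite ?scale0r ?mul0r.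
  - move=> v w r s [t t0 [-> ->]] [u u0 [-> ->]]; exists (t + u).
      exact: addr_ge0.
    by rewrite scalerDl mulrDl.
  - move=> t v r t0 [u u0 [-> ->]]; exists (t * u); first exact: mulr_ge0.
    by rewrite scalerA mulrA.
have G0 v r : G v r -> 0 <= q (- v) + r.
  move=> [t t0 [-> ->]]; rewrite -scalerN sq.2 // -mulrDr mulr_ge0 //; lra.
(* By minimality of q, cutting off the slice of q at x uncovers some a in A. *)
have [y [Yy ylt]] : exists y, Y y /\ infconv q G y < p y.
  apply: contrapT => nex.
  have /(congr1 (@^~ x)) : infconv q G = q.
    apply: qmin; [exact: sublinear_infconv|exact: infconv_le_self|].
    by move=> y Yy; rewrite leNgt; apply/negP => ylt; apply: nex; exists y.
  have /(infconv_le sq G0 x) : G x (q x - eta).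
    by exists 1 => //; rewrite scale1r mul1r.
  by rewrite /= subrr (sublinear0 sq) => h1 h2; lra.
have [_ [v [r [[t t0 [-> ->]] ->]]]] : exists2 s, (exists v r, G v r /\
    s = q (y - v) + r) & s < p y.
  apply: inf_lt ylt; exists (q (y - 0) + 0), 0, 0; split=> //.
  by case: cG.
set r0 := _ + _ => r0lt.
exists y, r0; split=> //.
  have [|_ [a Aa <-] lta] := sup_gt _ r0lt; first by exists (a0 y), a0.
  by exists a.
(* Since f is at most q at [y - t *: x], a value [f y] above r0 forces [f x] above [q x - eta]; here
   t cannot be 0. *)
have in_slice a f : linear_form f -> (forall z, f z <= q z) ->
    (forall z, Y z -> f z = a z) -> r0 < a y -> q x - eta < f x.
  move=> lf fq fa; rewrite -fa // /r0 => r0a.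
  have h1 := fq (y - t *: x); rewrite (linear_formB _ _ lf) lf.2 in h1.
  have h2 : t * (q x - eta) < t * f x by lra.
  case: (ltP 0 t) => [tp|tn]; first by rewrite -(ltr_pM2l tp).
  have tE : t = 0 by apply/le_anti; rewrite tn t0.
  by move: h2; rewrite tE !mul0r ltxx.
move=> a b Aa Ab ra rb; have [f [lf fq fa]] := ext a Aa.
have [g [lg gq gb]] := ext b Ab; apply: (close a b f g) => //.
  exact: in_slice fa ra.
exact: in_slice gb rb.
Qed.

End Dentability.

(** * Separability of the dual seminorm on separable subspaces *)

Section DualSeparable.
Variables (R : realType) (X : completeNormedModType R) (Y : set X).
Implicit Types (S : set (X -> R)) (e : R).

Lemma unit_form0 : unit_form (fun _ : X => 0 : R).
Proof. by split=> //; split=> *; rewrite ?addr0 ?mulr0. Qed.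

Let close e (f g : X -> R) := forall z, Y z -> `|f z - g z| <= e * `|z|.

Let covered e S := exists d : nat -> X -> R, (forall n, unit_form (d n)) /\
  forall f, S f -> exists n, close e f (d n).

Let covered_bigcup (K : countType) e (S : K -> set (X -> R)) :
  (forall k, covered e (S k)) -> covered e (\bigcup_k S k).
Proof.
move=> /choice[d dP].
exists (fun n => if unpickle n is Some p then d (p : K * nat).1 p.2 else fun=> 0).
split=> [n|f [k _ Sf]].
  by case: unpickle => [p|]; [exact: (dP _).1|exact: unit_form0].
have [n dn] := (dP k).2 f Sf; exists (pickle (k, n)).
by rewrite pickleK.
Qed.

(** A Cantor-Bendixson argument: remove the countably many rational slices that can be covered by
    countably many e-balls. If something remained, dentability would give it a small slice, hence
    one more coverable rational slice. *)
Lemma dual_separable (c : nat -> X) : Asplund X -> linear_subspace Y ->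
  (forall n, Y (c n)) ->
  (forall y e, Y y -> 0 < e -> exists n, `|y - c n| < e) ->
  exists d : nat -> X -> R, (forall n, unit_form (d n)) /\
    forall f e, unit_form f -> 0 < e ->
      exists n, forall z, Y z -> `|f z - d n z| <= e * `|z|.
Proof.
move=> aX sY Yc dc.
suff cov e : 0 < e -> covered e [set f | unit_form f].
  have [d dP] := choice (fun k : nat => cov k.+1%:R^-1 ltac:(by [])).
  exists (fun n => if unpickle n is Some p then d (p : nat * nat).1 p.2
                   else fun=> 0).
  split=> [n|f e cf e0].
    by case: unpickle => [p|]; [exact: (dP _).1|exact: unit_form0].
  pose k := Num.truncn e^-1.
  have ke : k.+1%:R^-1 <= e :> R.
    by rewrite -[e]invrK lef_pV2 ?posrE ?invr_gt0 //; apply/ltW/truncnS_gt.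
  have [n dn] := (dP k).2 f cf; exists (pickle (k, n)).
  rewrite pickleK /= => z Yz; apply: le_trans (dn z Yz) _.
  by rewrite ler_wpM2r.
move=> e0.
pose sl (k : nat * rat) := [set f : X -> R | unit_form f /\ ratr k.2 < f (c k.1)].
pose U k := [set f | sl k f /\ covered e (sl k)].
pose A := [set f | unit_form f /\ forall k, sl k f -> ~ covered e (sl k)].
have covU : covered e (\bigcup_k U k).
  apply: covered_bigcup => k.
  have [Ck|nCk] := pselect (covered e (sl k)).
    by have [d [dc1 dP]] := Ck; exists d; split=> // f [/dP].
  by exists (fun _ _ => 0); split=> [_|f [_ /nCk]] //; exact: unit_form0.
have splitA f : unit_form f -> A f \/ (\bigcup_k U k) f.
  move=> cf; have [Uf|nUf] := pselect ((\bigcup_k U k) f); [by right|left].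
  by split=> // k sf Ck; apply: nUf; exists k.
have [A0|/set0P A0] := eqVneq A set0.
  have [d [dc1 dP]] := covU; exists d; split=> // f cf.
  by apply: dP; case: (splitA f cf) => //; rewrite A0.
have [|y [r [Yy [a Aa ra] small]]] := dentable aX sY A0 _ e0.
  by move=> a [].
(* A rational slice around [a y > r] would be covered, as its part in A is
   contained in one ball. *)
exfalso; pose s := (a y - r) / 4.
have s0 : 0 < s by rewrite divr_gt0 // subr_gt0.
have [n cn] := dc y s Yy s0.
have [q /andP[q1 q2]] : exists q : rat, r + s < ratr q < r + 2 * s.
  have rs : r + s < r + 2 * s by lra.
  by have [q] := rat_in_itvoo rs; rewrite in_itv /=; exists q.
have fy f : unit_form f -> `|f y - f (c n)| < s.
  move=> cf; rewrite -(linear_formB _ _ cf.1); apply: le_lt_trans cn.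
  exact: unit_form_normr.
have ska : sl (n, q) a.
  split; first exact: Aa.1.
  have := fy a Aa.1 => /ltr_normlP[_] /=; rewrite /s in s0 q2 *; lra.
case: (Aa) => ca /(_ _ ska); apply.
have : covered e (\bigcup_(b in [set: bool]) if b then \bigcup_k U k else
    [set f | close e f a]).
  apply: covered_bigcup => -[//|].
  by exists (fun=> a); split=> // f fa; exists 0%N.
move=> [d [dc1 dP]]; exists d; split=> // f [cf qf]; apply: dP.
case: (splitA f cf) => Af; last by exists true.
exists false => // z Yz; apply: small => //.
by have := fy f cf => /ltr_normlP[]; move: qf => /=; lra.
Qed.

End DualSeparable.

(** * Smooth approximation of the norm *)

Lemma cauchy_seq_cvg (R : realType) (X : completeNormedModType R)
    (u : nat -> X) :
  (forall e : R, 0 < e -> exists n, forall i j, (n <= i)%N -> (n <= j)%N ->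
    `|u i - u j| < e) -> cvgn u.
Proof.
move=> H; apply/cauchy_cvgP/cauchyP => e e0; have [n Hn] := H e e0.
exists (u n); suff : \forall i \near \oo, ball (u n) e (u i) by [].
near=> i; rewrite -ball_normE /=; apply: Hn => //.
by near: i; exact: nbhs_infty_ge.
Unshelve. all: by end_near. Qed.

Section SmoothApproximation.
Variables (R : realType) (V : lmodType R) (N : V -> R) (W : set V).
Hypotheses (sN : sublinear N) (NN : forall x, N (- x) = N x).
Hypothesis sW : linear_subspace W.
Variable c : nat -> V.
Hypothesis Wc : forall n, W (c n).
Hypothesis dc : forall y e, W y -> 0 < e -> exists n, N (y - c n) < e.

Let B : set (V -> R) := [set f | linear_form f /\ forall x, f x <= N x].

(** The dense forms need not lie in B: on X^n they are sums of n unit forms, hence the bound M. *)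
Variables (d : nat -> V -> R) (M : R).
Hypothesis M0 : 0 <= M.
Hypothesis ld : forall n, linear_form (d n).
Hypothesis dM : forall n x, d n x <= M * N x.
Hypothesis dd : forall f e, B f -> 0 < e ->
  exists n, forall z, W z -> `|f z - d n z| <= e * N z.

Let N_ge0 x : 0 <= N x.
Proof. by have := sublinear_ge x sN; rewrite NN; lra. Qed.

Let normB f x : B f -> `|f x| <= N x.
Proof.
move=> [lf fN]; rewrite ler_norml fN andbT.
by have := fN (- x); rewrite (linear_formN _ lf) NN; lra.
Qed.

Let normd n x : `|d n x| <= M * N x.
Proof.
rewrite ler_norml dM andbT.
by have := dM n (- x); rewrite (linear_formN _ (ld n)) NN; lra.
Qed.

Let ball1 : set V := [set z | W z /\ N z <= 1].

(* The penalty Phi is convex and pointwise lower semicontinuous.  The squares of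
   psi make maximizing sequences of f y - Phi f converge pointwise on W; then
   each distance to d k converges too, and this turns the convergence into
   norm convergence because the d k are dense. *)
Let psi k (f : V -> R) : R := f (c k) / (1 + N (c k)).
Let u k z f : R := (`|f z - d k z| / (1 + M) + psi k f ^+ 2).
Let t k f : R := sup [set u k z f | z in ball1].
Let w k : R := 2^-1 ^+ k.+2.
Let Phi f : R := sup [set \sum_(k < K) w k * t k f | K in [set: nat]].

Let w0 k : 0 < w k. Proof. by rewrite exprn_gt0. Qed.

(** Total weight at most 1/2 and each [t k] at most 2 give a penalty between 0 and 1. *)
Let sumw K : \sum_(k < K) w k <= 2^-1.
Proof.
suff -> : \sum_(k < K) w k = 2^-1 - 2^-1 ^+ K.+1.
  by rewrite gerBl exprn_ge0.
elim: K => [|K IH]; first by rewrite big_ord0 expr1 subrr.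
by rewrite big_ord_recr /= IH /w; rewrite !exprS; lra.
Qed.

Let ball10 : ball1 0.
Proof. by split; [exact: sW.1|rewrite (sublinear0 sN)]. Qed.

Let psi1 k f : B f -> psi k f ^+ 2 <= 1.
Proof.
move=> Bf; rewrite -[leLHS]ger0_norm ?sqr_ge0 // normrX expr_le1 //.
rewrite normrM normfV.
rewrite (@ger0_norm _ (1 + _)) ?addr_ge0 // ler_pdivrMr ?ltr_pwDl //.
by rewrite mul1r (le_trans (normB _ Bf)) // lerDr.
Qed.

Let u2 k z f : B f -> ball1 z -> 0 <= u k z f <= 2.
Proof.
move=> Bf [Wz z1]; have M1 : 0 < 1 + M by rewrite ltr_pwDl.
rewrite /u addr_ge0 ?sqr_ge0 ?divr_ge0 ?(ltW M1) //=.
apply: (@le_trans _ _ (1 + 1)); last by rewrite lexx.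
apply: lerD; last exact: psi1.
rewrite ler_pdivrMr // mul1r; apply: le_trans (ler_normB _ _) _.
apply: lerD; first exact: le_trans (normB _ Bf) z1.
by apply: le_trans (normd _ _) _; rewrite -[leRHS]mulr1 ler_wpM2l.
Qed.

Let ut k z f : B f -> ball1 z -> u k z f <= t k f.
Proof.
move=> Bf bz; apply: ub_le_sup; last by exists z.
by exists 2 => _ [x bx <-]; case/andP: (u2 k Bf bx).
Qed.

Let t_le k f a : (forall z, ball1 z -> u k z f <= a) -> t k f <= a.
Proof.
move=> H; apply: ge_sup; first by exists (u k 0 f), 0.
by move=> _ [z bz <-]; exact: H.
Qed.

Let t_ge0 k f : B f -> 0 <= t k f.
Proof. by move=> Bf; apply: le_trans (ut k Bf ball10); case/andP: (u2 k Bf ball10). Qed.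

Let t_le2 k f : B f -> t k f <= 2.
Proof. by move=> Bf; apply: t_le => z bz; case/andP: (u2 k Bf bz). Qed.

Let S_le1 f K : B f -> \sum_(k < K) w k * t k f <= 1.
Proof.
move=> Bf; have := sumw K; rewrite -(@ler_pM2l _ 2) // mulfV // mulr_sumr.
apply: le_trans; apply: ler_sum => k _; rewrite mulrC ler_pM2r //; exact: t_le2.
Qed.

Let S_Phi f K : B f -> \sum_(k < K) w k * t k f <= Phi f.
Proof.
move=> Bf; apply: ub_le_sup; last by exists K.
by exists 1 => _ [L _ <-]; exact: S_le1.
Qed.

Let Phi_le f a : (forall K, \sum_(k < K) w k * t k f <= a) -> Phi f <= a.
Proof.
move=> H; apply: ge_sup; first by exists (\sum_(k < 0) w k * t k f), 0%N.
by move=> _ [K _ <-].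
Qed.

Let Phi_ge0 f : B f -> 0 <= Phi f.
Proof. by move=> Bf; apply: le_trans (S_Phi 0 Bf); rewrite big_ord0. Qed.

Let Phi_le1 f : B f -> Phi f <= 1.
Proof. by move=> Bf; apply: Phi_le => K; exact: S_le1. Qed.

Let mid (f g : V -> R) : V -> R := fun z => (f z + g z) / 2.

Let B_mid f g : B f -> B g -> B (mid f g).
Proof.
move=> [lf fN] [lg gN]; split.
  by split=> [x y|a x]; rewrite /mid; [rewrite lf.1 lg.1|rewrite lf.2 lg.2]; lra.
by move=> x; rewrite /mid; have := fN x; have := gN x; lra.
Qed.

(** Convexity of the absolute value and the parallelogram identity for [psi k]; the gain is
    independent of z and so survives the supremum. *)
Let t_mid k f g : B f -> B g ->
  t k (mid f g) <= (t k f + t k g) / 2 - ((psi k f - psi k g) / 2) ^+ 2.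
Proof.
move=> Bf Bg; apply: t_le => z bz.
have h1 := ut k Bf bz; have h2 := ut k Bg bz.
apply: (@le_trans _ _ ((u k z f + u k z g) / 2 -
  ((psi k f - psi k g) / 2) ^+ 2)); last by lra.
have -> : (u k z f + u k z g) / 2 - ((psi k f - psi k g) / 2) ^+ 2 =
    (`|f z - d k z| + `|g z - d k z|) / 2 / (1 + M) + psi k (mid f g) ^+ 2.
  have -> : psi k (mid f g) = (psi k f + psi k g) / 2 by rewrite /psi /mid; lra.
  by rewrite /u; lra.
rewrite lerD2r ler_pM2r ?invr_gt0 ?ltr_pwDl //.
have -> : mid f g z - d k z = (f z - d k z) / 2 + (g z - d k z) / 2.
  by rewrite /mid; lra.
apply: le_trans (ler_normD _ _) _.
by rewrite !normrM [`|2^-1|]ger0_norm ?invr_ge0 // -mulrDl.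
Qed.

Let Phi_mid k f g : B f -> B g ->
  Phi (mid f g) <= (Phi f + Phi g) / 2 - w k * ((psi k f - psi k g) / 2) ^+ 2.
Proof.
move=> Bf Bg; apply: Phi_le => K0.
(* The partial sum must contain the k-th term for its gain to be visible. *)
pose K := maxn K0 k.+1.
have kK : (k < K)%N by rewrite leq_max leqnn orbT.
apply: (@le_trans _ _ (\sum_(j < K) w j * t j (mid f g))).
  have K0K : (K0 <= K)%N by rewrite leq_max leqnn.
  rewrite -(big_mkord xpredT (fun j => w j * t j (mid f g))).
  rewrite -(big_mkord xpredT (fun j => w j * t j (mid f g))).
  rewrite (big_cat_nat (leq0n K0) K0K) //= lerDl; apply: sumr_ge0 => j _.
  by rewrite mulr_ge0 ?(ltW (w0 j)) // t_ge0 //; exact: B_mid.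
have h1 := S_Phi K Bf; rewrite (bigD1 (Ordinal kK)) //= in h1.
have h2 := S_Phi K Bg; rewrite (bigD1 (Ordinal kK)) //= in h2.
rewrite (bigD1 (Ordinal kK)) //=.
have h3 : w k * t k (mid f g) <=
    w k * ((t k f + t k g) / 2 - ((psi k f - psi k g) / 2) ^+ 2).
  by rewrite ler_pM2l //; exact: t_mid.
have h4 : \sum_(i < K | i != Ordinal kK) w i * t i (mid f g) <=
    (\sum_(i < K | i != Ordinal kK) w i * t i f +
     \sum_(i < K | i != Ordinal kK) w i * t i g) / 2.
  rewrite -big_split /= mulr_suml; apply: ler_sum => i _.
  rewrite -mulrDr -mulrA ler_pM2l //.
  apply: le_trans (t_mid i Bf Bg) _; rewrite gerBl; exact: sqr_ge0.
lra.
Qed.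

Let cvgW (fs : nat -> V -> R) (l : V -> R) :=
  forall z, W z -> (fun j => fs j z) @ \oo --> l z.

Let u_cvg k z fs l : W z -> cvgW fs l -> (fun j => u k z (fs j)) @ \oo --> u k z l.
Proof.
move=> Wz cf; apply: cvgD.
  by apply: cvgMl; apply: cvg_norm; apply: cvgB; [exact: cf|exact: cvg_cst].
by apply: cvgM; apply: cvgMl; exact: cf.
Qed.

Let t_lsc k fs l g : (forall j, B (fs j)) -> cvgW fs l -> 0 < g ->
  \forall j \near \oo, t k l - g < t k (fs j).
Proof.
move=> Bf cf g0.
have [||_ [z bz <-] Hz] := @sup_gt _ [set u k z l | z in ball1] (t k l - g).
- by exists (u k 0 l), 0.
- by rewrite ltrBlDr ltrDl.
near=> j; apply: lt_le_trans (ut k (Bf j) bz).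
by near: j; exact: (cvgr_gt _ (@u_cvg k _ _ _ bz.1 cf) _ Hz).
Unshelve. all: by end_near.
Qed.

(** Lower semicontinuity with the n-th term kept apart: if the values [Phi (fs j)] do not exceed
    [Phi l] in the limit, then no single [t n (fs j)] can stay above [t n l]. *)
Let Phi_lsc n fs l g : (forall j, B (fs j)) -> B l -> cvgW fs l -> 0 < g ->
  \forall j \near \oo, Phi l + w n * (t n (fs j) - t n l) - g < Phi (fs j).
Proof.
move=> Bf Bl cf g0; have g2 : 0 < g / 2 by rewrite divr_gt0.
have [||_ [K0 _ <-] HK0] := @sup_gt _
  [set \sum_(k < K) w k * t k l | K in [set: nat]] (Phi l - g / 2).
- by exists (\sum_(k < 0) w k * t k l), 0%N.
- by rewrite ltrBlDr ltrDl.
pose K := maxn K0 n.+1.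
have nK : (n < K)%N by rewrite leq_max leqnn orbT.
have HK : Phi l - g / 2 < \sum_(j < K) w j * t j l.
  apply: lt_le_trans HK0 _.
  have K0K : (K0 <= K)%N by rewrite leq_max leqnn.
  rewrite -(big_mkord xpredT (fun j => w j * t j l)).
  rewrite -(big_mkord xpredT (fun j => w j * t j l)).
  rewrite (big_cat_nat (leq0n K0) K0K) //= lerDl; apply: sumr_ge0 => j _.
  by rewrite mulr_ge0 ?(ltW (w0 j)) // t_ge0.
have : \forall j \near \oo, forall i : 'I_K, t i l - g < t i (fs j).
  by apply: filter_forall => i; exact: t_lsc.
apply: filterS => j Hj.
apply: lt_le_trans (S_Phi K (Bf j)).
rewrite (bigD1 (Ordinal nK)) //= in HK; rewrite (bigD1 (Ordinal nK)) //=.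
suff : \sum_(i < K | i != Ordinal nK) w i * t i l - g / 2 <=
    \sum_(i < K | i != Ordinal nK) w i * t i (fs j) by lra.
rewrite lerBlDr -lerBlDl -sumrB.
apply: (@le_trans _ _ (\sum_(i < K | i != Ordinal nK) w i * g)).
  by apply: ler_sum => i _; rewrite -mulrBr ler_pM2l //; have := Hj i; lra.
rewrite -mulr_suml mulrC ler_pM2l //; apply: le_trans (sumw K).
by rewrite [leRHS](bigD1 (Ordinal nK)) //= lerDr ltW.
Qed.

Let close e (f g : V -> R) := forall z, W z -> `|f z - g z| <= e * N z.

Section At.
Variables (kappa : R) (y : V).
Hypotheses (k0 : 0 < kappa) (Wy : W y).
Let F f := f y - kappa * Phi f.
Let m := sup [set F f | f in B].

Let B0 : B (fun=> 0).
Proof. by split=> [|x]; [split=> *; rewrite ?addr0 ?mulr0|exact: N_ge0]. Qed.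

Let F_le f : B f -> F f <= m.
Proof.
move=> Bf; apply: ub_le_sup; last by exists f.
exists (N y) => _ [g Bg <-]; rewrite /F.
by have := Bg.2 y; have := mulr_ge0 (ltW k0) (Phi_ge0 Bg); lra.
Qed.

Let F_mid k f g : B f -> B g ->
  kappa * w k * ((psi k f - psi k g) / 2) ^+ 2 <= m - (F f + F g) / 2.
Proof.
move=> Bf Bg; have := F_le (B_mid Bf Bg); have := Phi_mid k Bf Bg.
rewrite -(ler_pM2l k0) /F /mid; lra.
Qed.

Let maximizing fs := (forall j, B (fs j)) /\
  forall g, 0 < g -> \forall j \near \oo, m - g < F (fs j).

(** Strict concavity makes the values at each [c k] Cauchy; density of the [c k] and the common
    bound N extend this to W. *)
Let maximizing_cvg fs : maximizing fs -> exists l, B l /\ cvgW fs l.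
Proof.
move=> [Bf Ff].
have cs z : W z -> cvgn (fun j => fs j z : R^o).
  move=> Wz; apply: cauchy_seq_cvg => e e0.
  have e8 : 0 < e / 8 by rewrite divr_gt0.
  have [k ck] := dc Wz e8.
  pose a := e / 4 / (1 + N (c k)); have Nc1 : 0 < 1 + N (c k) by rewrite ltr_pwDl.
  have a0 : 0 < a by rewrite !divr_gt0.
  (* Two forms within g of the supremum have [psi k] values less than a apart, by [F_mid]. *)
  pose g := kappa * w k * (a / 2) ^+ 2.
  have kw : 0 < kappa * w k by exact: mulr_gt0.
  have g0 : 0 < g.
    by apply: mulr_gt0; [exact: mulr_gt0|apply: exprn_gt0; exact: divr_gt0].
  have [n _ Hn] := Ff g g0; exists n => i j ni nj.
  have h1 := Hn i ni; have h2 := Hn j nj; rewrite /= in h1 h2.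
  have h3 := F_mid k (Bf i) (Bf j).
  have h4 : `|psi k (fs i) - psi k (fs j)| < a.
    have : ((psi k (fs i) - psi k (fs j)) / 2) ^+ 2 < (a / 2) ^+ 2.
      rewrite -(ltr_pM2l kw) -/g; apply: le_lt_trans h3 _.
      by move: h1 h2; generalize g => g1; lra.
    rewrite -[ltLHS]ger0_norm ?sqr_ge0 // normrX ltr_pXn2r //; last first.
      by rewrite nnegrE divr_ge0 // ltW.
    by rewrite normrM (@ger0_norm _ 2^-1) ?invr_ge0 // ltr_pM2r ?invr_gt0.
  have h5 : `|fs i (c k) - fs j (c k)| < e / 4.
    move: h4; rewrite /psi -mulrBl normrM normfV (gtr0_norm Nc1).
    by rewrite ltr_pM2r ?invr_gt0.
  have h6 : `|fs i (z - c k)| < e / 8 by exact: le_lt_trans (normB _ (Bf i)) ck.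
  have h7 : `|fs j (z - c k)| < e / 8 by exact: le_lt_trans (normB _ (Bf j)) ck.
  move: h5 h6 h7; rewrite !ltr_norml.
  rewrite (linear_formB _ _ (Bf i).1) (linear_formB _ _ (Bf j).1).
  by move=> /andP[? ?] /andP[? ?] /andP[? ?]; apply/andP; split; lra.
pose l0 z := limn (fun j => fs j z : R^o).
have cl0 z : W z -> (fun j => fs j z : R^o) @ \oo --> (l0 z : R^o) := cs z.
have l0D x z : W x -> W z -> l0 (x + z) = l0 x + l0 z.
  move=> Wx Wz; apply/(@cvg_lim _ (@Rhausdorff R)).
  rewrite (_ : (fun j => _) = (fun j => fs j x + fs j z)).
    by apply: cvgD; exact: cl0.
  by apply/funext => j; rewrite (Bf j).1.1.
have l0Z a x : W x -> l0 (a *: x) = a * l0 x.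
  move=> Wx; apply/(@cvg_lim _ (@Rhausdorff R)).
  rewrite (_ : (fun j => _) = (fun j => a * fs j x)).
    by apply: cvgMr; exact: cl0.
  by apply/funext => j; rewrite (Bf j).1.2.
have l0N x : W x -> l0 x <= N x.
  move=> Wx; apply: limr_le; first exact: cs.
  by apply: nearW => j; exact: (Bf j).2.
(* The limit is linear only on W, whereas B asks for a form bounded by N on all of V. *)
have [l [ll lN lE]] := linear_form_extension sN sW l0D l0Z l0N.
by exists l; split=> // z Wz; rewrite lE //; exact: cl0.
Qed.

Let maximizing_max fs l : maximizing fs -> B l -> cvgW fs l -> F l = m.
Proof.
move=> [Bf Ff] Bl cl; apply/le_anti; rewrite F_le //=.
apply/ler_addgt0Pl => e e0.
have e8 : 0 < e / 8 by rewrite divr_gt0.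
have ek : 0 < e / 8 / kappa by rewrite divr_gt0.
have [j [h1 [h2 [h3 h4]]]] : exists j, m - e / 8 < F (fs j) /\
   Phi l + w 0 * (t 0 (fs j) - t 0 l) - e / 8 / kappa < Phi (fs j) /\
   t 0 l - e / 8 / kappa < t 0 (fs j) /\ fs j y < l y + e / 8.
  apply: (@filter_ex _ \oo); near=> j.
  split; first by near: j; exact: Ff.
  split; first by near: j; exact: Phi_lsc.
  split; first by near: j; exact: t_lsc.
  by near: j; apply: (cvgr_lt _ (cl y Wy)); rewrite ltrDl.
have wk1 : w 0 * (t 0 l - t 0 (fs j)) <= e / 8 / kappa.
  apply: (@le_trans _ _ (w 0 * (e / 8 / kappa))).
    by rewrite ler_pM2l //; lra.
  by rewrite ler_piMl ?(ltW ek) // exprn_ile1 // invf_le1 // ler1n.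
have : kappa * Phi l < kappa * (Phi (fs j) + 2 * (e / 8 / kappa)).
  by rewrite ltr_pM2l //; lra.
have -> : kappa * (Phi (fs j) + 2 * (e / 8 / kappa)) = kappa * Phi (fs j) + e / 4.
  by field; rewrite gt_eqF.
by move: h1; rewrite /F; lra.
Unshelve. all: by end_near. Qed.

(** Values of F converge to the maximum and [fs j y] to [l y], so Phi does not jump; by [Phi_lsc]
    neither does [t n]. With [d n] close to l and [psi n] convergent, the supremum defining
    [t n (fs j)] bounds the distance to [d n] uniformly on the unit ball of W. *)
Let maximizing_close fs l e : maximizing fs -> B l -> cvgW fs l -> 0 < e ->
  \forall j \near \oo, close e (fs j) l.
Proof.
move=> mf Bl cl e0; have Fl := maximizing_max mf Bl cl.
case: mf => Bf Ff.
have M1 : 0 < 1 + M by rewrite ltr_pwDl.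
have e4 : 0 < e / 4 by rewrite divr_gt0.
have [n ln] := dd Bl e4.
pose a := e / 4 / (1 + M); have a0 : 0 < a by rewrite divr_gt0.
have tl : t n l <= a + psi n l ^+ 2.
  apply: t_le => z [Wz z1]; rewrite lerD2r ler_pM2r ?invr_gt0 //.
  by apply: le_trans (ln z Wz) _; rewrite ler_piMr // ltW.
pose b := a / 4; have b0 : 0 < b by rewrite divr_gt0.
have wb0 : 0 < w n * b by rewrite mulr_gt0.
have kwb0 : 0 < kappa * (w n * b) by rewrite mulr_gt0.
near=> j.
have h1 : m - kappa * (w n * b) < F (fs j) by near: j; exact: Ff.
have h2 : Phi l + w n * (t n (fs j) - t n l) - w n * b < Phi (fs j).
  by near: j; exact: Phi_lsc.
have h3 : fs j y < l y + kappa * (w n * b).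
  by near: j; apply: (cvgr_lt _ (cl y Wy)); rewrite ltrDl.
have h4 : psi n l ^+ 2 - b < psi n (fs j) ^+ 2.
  near: j; apply: (@cvgr_gt _ _ \oo _ (fun j => psi n (fs j) ^+ 2) (psi n l ^+ 2)).
    by apply: cvgM; apply: cvgMl; exact: cl.
  by rewrite ltrBlDr ltrDl.
have h5 : Phi (fs j) < Phi l + 2 * (w n * b).
  by rewrite -(ltr_pM2l k0); move: h1; rewrite -Fl /F; lra.
have h6 : t n (fs j) - t n l < 3 * b.
  by rewrite -(ltr_pM2l (w0 n)); lra.
have h7 z : ball1 z -> `|fs j z - l z| <= e.
  move=> bz; have := ut n (Bf j) bz; rewrite /u => h7.
  have h8 : `|fs j z - d n z| / (1 + M) <= 2 * a by move: h6 h4 h7 tl; rewrite /b; lra.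
  have h9 : `|fs j z - d n z| <= e / 2.
    have aM : a * (1 + M) = e / 4 by rewrite /a mulfVK ?gt_eqF.
    by move: h8; rewrite ler_pdivrMr // -mulrA aM; lra.
  have h10 : `|l z - d n z| <= e / 4.
    by apply: le_trans (ln z bz.1) _; rewrite ler_piMr ?(ltW e4) // bz.2.
  by apply: le_trans (ler_distD (d n z) _ _) _; rewrite [`|d n z - _|]distrC; lra.
move=> z Wz; have := N_ge0 z; rewrite le_eqVlt => /predU1P[z0|z0].
  rewrite -z0 mulr0; apply: le_trans (ler_normB _ _) _.
  by have := normB z (Bf j); have := normB z Bl; rewrite -z0; lra.
have /h7 : ball1 ((N z)^-1 *: z).
  by split; [exact: linear_subspaceZ|rewrite sN.2 ?invr_ge0 ?(ltW z0) // mulVf ?gt_eqF].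
rewrite (Bf j).1.2 Bl.1.2 -mulrBr normrM gtr0_norm ?invr_gt0 //.
by rewrite ler_pdivrMl // mulrC.
Unshelve. all: by end_near. Qed.

Let maximizing_exists : exists fs, maximizing fs.
Proof.
have H (j : nat) : exists f, B f /\ m - j.+1%:R^-1 < F f.
  have [||_ [f Bf <-] Hf] := @sup_gt _ [set F f | f in B] (m - j.+1%:R^-1).
  - by exists (F (fun=> 0)), (fun=> 0).
  - by rewrite ltrBlDr ltrDl.
  by exists f.
have [fs fsP] := choice H; exists fs; split=> [j|g g0].
  by have [] := fsP j.
near=> j; have [_] := fsP j; apply: le_lt_trans.
rewrite lerD2l lerN2 ltW //; near: j; exact: near_infty_natSinv_lt (PosNum g0).
Unshelve. all: by end_near. Qed.

(** A strong maximum: forms that are not close to l but nearly maximize F would make up a maximizing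
    sequence staying away from its limit. *)
Let maximizer : exists l, [/\ B l, F l = m &
  forall e, 0 < e -> exists2 g, 0 < g &
    forall f, B f -> m - g < F f -> close e f l].
Proof.
have [fs mf] := maximizing_exists.
have [l [Bl cl]] := maximizing_cvg mf.
have Fl := maximizing_max mf Bl cl.
exists l; split=> // e e0; apply: contrapT => nH.
have H (j : nat) : exists f, [/\ B f, m - j.+1%:R^-1 < F f & ~ close e f l].
  apply: contrapT => nf; apply: nH; exists j.+1%:R^-1 => // f Bf Ff.
  by apply: contrapT => nc; apply: nf; exists f.
have [gs gsP] := choice H.
have mg : maximizing gs.
  split=> [j|g g0]; first by have [] := gsP j.
  near=> j; have [_ + _] := gsP j; apply: le_lt_trans.
  rewrite lerD2l lerN2 ltW //; near: j; exact: near_infty_natSinv_lt (PosNum g0).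
have cg : cvgW gs l.
  have [l' [Bl' cl']] := maximizing_cvg mg.
  have Fl' := maximizing_max mg Bl' cl'.
  (* Both limits maximize F, so the strict convexity of Phi identifies them on
     the dense sequence c. *)
  have lc k : l (c k) = l' (c k).
    have := F_mid k Bl Bl'; rewrite Fl Fl' => h1.
    have h2 : (psi k l - psi k l') / 2 == 0.
      rewrite -sqrf_eq0; apply/eqP/le_anti; rewrite sqr_ge0 andbT.
      rewrite -(ler_pM2l (mulr_gt0 k0 (w0 k))) mulr0.
      by apply: le_trans h1 _; lra.
    have Nc1 : 0 < 1 + N (c k) by rewrite ltr_pwDl.
    have h3 : psi k l = psi k l' by move/eqP: h2; lra.
    by move: h3; rewrite /psi => /(mulIf _)-> //; rewrite invr_eq0 gt_eqF.
  move=> z Wz; suff -> : l z = l' z by exact: cl'.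
  apply/eqP; rewrite -subr_eq0 -normr_eq0; apply/eqP/le_anti.
  rewrite normr_ge0 andbT; apply/ler_addgt0Pl => a a0; rewrite addr0.
  have a2 : 0 < a / 2 by rewrite divr_gt0.
  have [k ck] := dc Wz a2.
  have := le_lt_trans (normB _ Bl) ck; have := le_lt_trans (normB _ Bl') ck.
  rewrite (linear_formB _ _ Bl.1) (linear_formB _ _ Bl'.1) lc !ltr_norml ler_norml.
  by move=> /andP[? ?] /andP[? ?]; apply/andP; split; lra.
have [j /=] := filter_ex (maximizing_close mg Bl cg e0).
by have [_ _ nc] := gsP j.
Unshelve. all: by end_near. Qed.

(** A strong maximum on the dual side is Frechet smoothness of the conjugate. Forms close to l
    satisfy the estimate directly; the others lose at least g, which outweighs the gain 2 N k once N
    k is below g / 2. *)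
Lemma sup_Frechet : exists l, [/\ B l, F l = m &
  forall e, 0 < e -> exists2 r, 0 < r &
    forall k f, W k -> N k < r -> B f ->
      f (y + k) - kappa * Phi f <= m + l k + e * N k].
Proof.
have [l [Bl Fl Hl]] := maximizer; exists l; split=> // e e0.
have [g g0 Hg] := Hl e e0; exists (g / 2); first by rewrite divr_gt0.
move=> k f Wk kr Bf.
have [fF|Ff] := ltP (m - g) (F f).
  have := Hg f Bf fF k Wk => /ler_normlP[_]; have := F_le Bf.
  by rewrite /F Bf.1.1; lra.
have := mulr_ge0 (ltW e0) (N_ge0 k).
have := Bf.2 k; have := Bl.2 (- k); rewrite NN (linear_formN _ Bl.1).
by move: Ff; rewrite /F Bf.1.1; lra.
Qed.

End At.

(** h is the conjugate of kappa Phi; since Phi takes values in [0, 1] on B, it differs from N by at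
    most kappa. *)
Lemma smooth_approximation kappa : 0 < kappa -> exists h : V -> R,
  [/\ forall z, N z - kappa <= h z, forall z, h z <= N z,
      forall x z, h x - h z <= N (x - z) &
      forall y, W y -> exists l, [/\ linear_form l, forall z, l z <= N z, h y <= l y &
        forall e, 0 < e -> exists2 r, 0 < r &
          forall k, W k -> N k < r -> h (y + k) <= h y + l k + e * N k]].
Proof.
move=> k0; pose h z := sup [set f z - kappa * Phi f | f in B].
have kPhi f : B f -> 0 <= kappa * Phi f <= kappa.
  move=> Bf; rewrite mulr_ge0 ?Phi_ge0 ?(ltW k0) //=.
  by rewrite ler_piMr ?(ltW k0) // Phi_le1.
have B0 : B (fun=> 0).
  by split=> [|x]; [split=> *; rewrite ?addr0 ?mulr0|exact: N_ge0].
have h_ge z f : B f -> f z - kappa * Phi f <= h z.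
  move=> Bf; apply: ub_le_sup; last by exists f.
  exists (N z) => _ [g Bg <-]; have := Bg.2 z.
  by have /andP[] := kPhi _ Bg; lra.
have h_le z a : (forall f, B f -> f z - kappa * Phi f <= a) -> h z <= a.
  move=> H; apply: ge_sup; first by exists (0 - kappa * Phi (fun=> 0)), (fun=> 0).
  by move=> _ [f Bf <-]; exact: H.
exists h; split.
(* The sandwich theorem along the ray of -z yields a form of B that attains N at z. *)
- move=> z; pose G v r := exists2 la, 0 <= la & v = - (la *: z) /\ r = - (la * N z).
  have cG : convex_cone G.
    split; first by exists 0; rewrite ?scale0r ?mul0r ?oppr0.
    + move=> v v' r s [la la0 [-> ->]] [lb lb0 [-> ->]]; exists (la + lb).
        exact: addr_ge0.
      by rewrite scalerDl mulrDl !opprD.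
    + move=> la v r la0 [lb lb0 [-> ->]]; exists (la * lb); first exact: mulr_ge0.
      by rewrite scalerN scalerA mulrN mulrA.
  have [|f [lf fN Gf]] := sandwich sN cG.
    by move=> v r [la la0 [-> ->]]; rewrite opprK sN.2 // subrr.
  have Bf : B f by [].
  have : f (- z) <= - N z.
    by apply: Gf; exists 1 => //; rewrite scale1r mul1r.
  rewrite (linear_formN _ lf); have := h_ge z f Bf; have /andP[] := kPhi f Bf; lra.
- move=> z; apply: h_le => f Bf; have := Bf.2 z.
  by have /andP[] := kPhi f Bf; lra.
- move=> x z; rewrite lerBlDr; apply: h_le => f Bf.
  by have := h_ge z f Bf; have := Bf.2 (x - z); rewrite (linear_formB _ _ Bf.1); lra.
- move=> y Wy; have [l [Bl Fl Hl]] := sup_Frechet k0 Wy.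
  exists l; split; [exact: Bl.1|exact: Bl.2| |].
    by have /andP[] := kPhi l Bl; move: Fl; rewrite -/(h y); lra.
  move=> e /Hl[r r0 Hr]; exists r => // k Wk kr.
  by apply: h_le => f Bf; exact: Hr.
Qed.

End SmoothApproximation.

(** * A smooth variational principle *)

Lemma expr_half_small (R : realType) (e : R) : 0 < e ->
  exists n, forall k, (n <= k)%N -> 2^-1 ^+ k < e.
Proof.
move=> e0; have h : `|2^-1 : R| < 1.
  by rewrite ger0_norm ?invr_ge0 // invf_lt1 // ltr1n.
have [n _ Hn] := cvgr_lt _ (cvg_expr h) _ e0.
by exists n => k nk; exact: Hn.
Qed.

Section VariationalPrinciple.
Variables (R : realType) (V : lmodType R) (N : V -> R) (S : set V).
Hypotheses (sN : sublinear N) (NN : forall x, N (- x) = N x).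
Hypothesis completeS : forall u : nat -> V, (forall n, S (u n)) ->
  (forall e, 0 < e -> exists n, forall i j, (n <= i)%N -> (n <= j)%N ->
    N (u i - u j) < e) ->
  exists x, S x /\ forall e, 0 < e -> exists n, forall i, (n <= i)%N ->
    N (u i - x) < e.
Variables (J : V -> R) (C al r : R) (H : nat -> V -> R) (z0 : V).
Hypotheses (C0 : 0 <= C) (JC : forall x z, J x - J z <= C * N (x - z)).
Hypotheses (al0 : 0 < al) (r0 : 0 < r).
Hypothesis H_ge : forall k z, N z - r * 2^-1 ^+ k.+2 <= H k z.
Hypothesis H_le : forall k z, H k z <= N z.
Hypothesis H_lip : forall k x z, H k x - H k z <= N (x - z).
Hypotheses (Sz0 : S z0) (Jz0 : forall z, S z -> J z0 <= J z + al * r / 16).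

Let pw k : R := 2^-1 ^+ k.
Let pw0 k : 0 < pw k. Proof. exact: exprn_gt0. Qed.
Let pwS k : pw k.+1 = pw k / 2. Proof. by rewrite /pw exprSr. Qed.

Let eps k := al * pw k.+1.
(** Quadratic decay: eta k / eps k is of order r 2^-k, so consecutive points are within r 2^-(k+1)
    and their distances sum to at most r. *)
Let eta k := al * r * pw k ^+ 2 / 16.

Let near_min k (G : V -> R) :=
  xget z0 [set z | S z /\ forall x, S x -> G z <= G x + eta k].

Let near_minP k G : (exists b, forall x, S x -> b <= G x) ->
  S (near_min k G) /\ forall x, S x -> G (near_min k G) <= G x + eta k.
Proof.
move=> [b Gb].
suff ex : exists z, S z /\ forall x, S x -> G z <= G x + eta k.
  exact: (@xgetPex _ z0
    [set z | S z /\ forall x, S x -> G z <= G x + eta k] ex).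
have eta0 : 0 < eta k by rewrite divr_gt0 ?mulr_gt0 ?exprn_gt0.
have [||_ [z Sz <-] Hz] := @inf_lt _ [set G x | x in S]
  (inf [set G x | x in S] + eta k).
- by exists (G z0), z0.
- by rewrite ltrDl.
exists z; split=> // x Sx; apply: le_trans (ltW Hz) _; rewrite lerD2r.
by apply: ge_inf; [exists b => _ [v Sv <-]; exact: Gb|exists x].
Qed.

Let step k (s : (V -> R) * V) :=
  let G := fun x => s.1 x + eps k * H k (x - s.2) in (G, near_min k.+1 G).
Let st k := iteri k step (J, z0).
Let G k := (st k).1.
Let zs k := (st k).2.

Let G_sum k x : G k x = J x + \sum_(j < k) eps j * H j (x - zs j).
Proof.
elim: k => [|k IH]; first by rewrite big_ord0 addr0.
by rewrite big_ord_recr /= addrA -IH.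
Qed.

Let GS k x : G k.+1 x = G k x + eps k * H k (x - zs k). Proof. by []. Qed.

Let N_ge0 x : 0 <= N x.
Proof. by have := sublinear_ge x sN; rewrite NN; lra. Qed.

Let eps0 k : 0 < eps k. Proof. by rewrite mulr_gt0. Qed.

Let G_lb k : exists b, forall x, S x -> b <= G k x.
Proof.
elim: k => [|k [b Hb]].
  by exists (J z0 - al * r / 16) => x /Jz0 /=; rewrite /G /=; lra.
exists (b - eps k * (r * 2^-1 ^+ k.+2)) => x /Hb.
have : eps k * - (r * 2^-1 ^+ k.+2) <= eps k * H k (x - zs k).
  by rewrite ler_pM2l //; have := H_ge k (x - zs k); have := N_ge0 (x - zs k); lra.
by rewrite GS; lra.
Qed.

Let zsP k : S (zs k) /\ forall x, S x -> G k (zs k) <= G k x + eta k.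
Proof.
case: k => [|k]; last exact/near_minP/(G_lb k.+1).
split=> // x Sx; apply: le_trans (Jz0 Sx) _.
by rewrite /G /eta /= /pw expr0 expr1n mulr1.
Qed.

Let zs_step k : N (zs k.+1 - zs k) <= r * pw k - r * pw k.+1.
Proof.
have [Sk Hk] := zsP k; have [Sk1 Hk1] := zsP k.+1.
have h1 := Hk _ Sk1; have := Hk1 _ Sk; rewrite !GS subrr => h2.
have h3 : eps k * H k 0 <= 0.
  by rewrite pmulr_rle0 //; apply: le_trans (H_le _ _) _; rewrite (sublinear0 sN).
have h4 : eps k * (N (zs k.+1 - zs k) - r * pw k.+2) <= 
    eps k * H k (zs k.+1 - zs k) by rewrite ler_pM2l //; exact: H_ge.
have p0 := pw0 k; have rp0 : 0 < r * pw k by rewrite mulr_gt0.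
have alp0 : 0 < al * pw k by rewrite mulr_gt0.
move: h1 h2 h4; rewrite /eta /eps !pwS; set p := pw k in p0 rp0 alp0 *.
set a := N _; set b := H k _; set b0 := H k 0 => h1 h2 h4.
move: h3; rewrite /eps !pwS -/p -/b0 => h3.
have h5 : al * p * (a - r * p / 2) <= 0.
  have : 0 <= al * p * (r * p) by rewrite mulr_ge0 ?ltW.
  lra.
move: h5; rewrite pmulr_rle0 //; lra.
Qed.

Let zs_dist i j : (i <= j)%N -> N (zs j - zs i) <= r * pw i - r * pw j.
Proof.
elim: j => [|j IH]; first by rewrite leqn0 => /eqP ->; rewrite !subrr (sublinear0 sN).
rewrite leq_eqVlt => /predU1P[->|]; first by rewrite !subrr (sublinear0 sN).
rewrite ltnS => /IH; have := zs_step j; have := sN.1 (zs j.+1 - zs j) (zs j - zs i).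
by rewrite addrA subrK; lra.
Qed.

(** The perturbations from K to L - 1 are Lipschitz with the sum of their weights as constant. *)
Let G_diff K L x z : (K <= L)%N ->
  G L x - G L z <= G K x - G K z + (al * pw K - al * pw L) * N (x - z).
Proof.
elim: L => [|L IH]; first by rewrite leqn0 => /eqP ->; rewrite subrr mul0r addr0.
rewrite leq_eqVlt => /predU1P[->|]; first by rewrite subrr mul0r addr0.
rewrite ltnS => /IH; rewrite !GS.
have : eps L * (H L (x - zs L) - H L (z - zs L)) <= eps L * N (x - z).
  rewrite ler_pM2l //; apply: le_trans (H_lip _ _ _) _.
  by rewrite opprB addrA subrK.
by rewrite /eps pwS; lra.
Qed.

(** The series of perturbations is cut at an arbitrary K and its tail replaced by a Lipschitz term
    of slope al 2^-K. For K = 0 this is Ekeland's principle, which is all that convex sets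
    require. *)
Theorem variational_principle : exists (z : nat -> V) (zb : V),
  [/\ forall k, S (z k), S zb, N (zb - z0) <= r & forall K x, S x ->
    J zb + \sum_(k < K) al * 2^-1 ^+ k.+1 * H k (zb - z k) <=
    J x + \sum_(k < K) al * 2^-1 ^+ k.+1 * H k (x - z k) +
      al * 2^-1 ^+ K * N (x - zb)].
Proof.
have zsS k : S (zs k) by case: (zsP k).
have [|zb [Szb czb]] := completeS zsS.
  move=> e e0; have [n Hn] := expr_half_small (divr_gt0 e0 r0).
  have main i j : (n <= i)%N -> (i <= j)%N -> N (zs j - zs i) < e.
    move=> ni ij; apply: le_lt_trans (zs_dist ij) _.
    have := Hn i ni; rewrite ltr_pdivlMr // mulrC => h.
    by apply: lt_trans h; rewrite gtrBl mulr_gt0.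
  exists n => i j ni nj; have [ij|/ltnW ji] := leqP i j; last exact: main.
  by rewrite -NN opprB; exact: main.
exists zs, zb; split=> //.
  apply/ler_addgt0Pl => e e0; have [n Hn] := czb e e0.
  have := sN.1 (zb - zs n) (zs n - z0); rewrite addrA subrK.
  have := Hn n (leqnn n); rewrite -NN opprB.
  have := zs_dist (leq0n n); rewrite -[zs 0]/z0 -[pw 0]/1 mulr1.
  by have := mulr_gt0 r0 (pw0 n); lra.
move=> K x Sx; rewrite -!G_sum -/(pw K).
have GK_lip v w : G K v - G K w <= (C + al) * N (v - w).
  have := G_diff v w (leq0n K); rewrite -[pw 0]/1 mulr1.
  have := JC v w; have := mulr_ge0 (mulr_ge0 (ltW al0) (ltW (pw0 K))) (N_ge0 (v - w)).
  by rewrite -[G 0]/J; lra.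
apply/ler_addgt0Pl => e e0.
have D0 : 0 < C + al + al * pw K + 1.
  by rewrite ltr_wpDl // !addr_ge0 // ltW // mulr_gt0.
have [n1 Hn1] := czb _ (divr_gt0 (divr_gt0 e0 (ltr0Sn R 1)) D0).
have alr0 : 0 < al * r by rewrite mulr_gt0.
have [n2 Hn2] := expr_half_small (divr_gt0 e0 alr0).
pose L := maxn K (maxn n1 n2).
have KL : (K <= L)%N by rewrite leq_max leqnn.
have h1 : N (zs L - zb) < e / 2 / (C + al + al * pw K + 1).
  by apply: Hn1; rewrite !leq_max leqnn orbT.
have h2 : eta L <= e / 16.
  have h : pw L < e / (al * r) by apply: Hn2; rewrite !leq_max leqnn !orbT.
  rewrite /eta ler_pM2r ?invr_gt0 //.
  apply: (@le_trans _ _ (al * r * pw L)).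
    by rewrite ler_pM2l // expr2 ger_pMl // exprn_ile1 // invf_le1 // ler1n.
  by move: h; rewrite ltr_pdivlMr // mulrC => /ltW.
have h3 := (zsP L).2 x Sx.
have h4 := G_diff x (zs L) KL.
have h5 := GK_lip zb (zs L).
have h6 : al * pw K * N (x - zs L) <= al * pw K * (N (x - zb) + N (zs L - zb)).
  rewrite ler_pM2l ?mulr_gt0 //.
  have := sN.1 (x - zb) (zb - zs L); rewrite addrA subrK.
  by rewrite -[N (zs L - zb)]NN opprB.
have h7 : 0 <= al * pw L * N (x - zs L) by rewrite !mulr_ge0 // ltW.
move: h1; rewrite ltr_pdivlMr // => h1.
move: h5; rewrite -[N (zb - _)]NN opprB => h5.
have h8 := N_ge0 (zs L - zb).
by move: h1 h2 h3 h4 h5 h6 h7; rewrite !mulrDr !mulrDl mulr1; lra.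
Qed.

End VariationalPrinciple.

(** * Separable reduction *)

Section CountableClosure.
Variables (K : countType) (T : Type) (x0 : T) (op : K -> seq T -> T).

Fixpoint eval_tree (t : GenTree.tree unit) : T :=
  match t with
  | GenTree.Leaf _ => x0
  | GenTree.Node n ts =>
      if unpickle n is Some k then op k [seq eval_tree t | t <- ts] else x0
  end.

(** Finite terms over the operations are countable, and the set of their values is closed under
    every operation. *)
Lemma countable_closure : exists c : nat -> T,
  forall k s, exists n, c n = op k [seq c i | i <- s].
Proof.
pose tr n : GenTree.tree unit := odflt (GenTree.Leaf tt) (unpickle n).
exists (eval_tree \o tr) => k s.
exists (pickle (GenTree.Node (pickle k) [seq tr i | i <- s])).
by rewrite /tr /= pickleK /= pickleK -map_comp.
Qed.

End CountableClosure.

(** * The maximum norm on finite powers of X *)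

Section MaxNorm.
Variables (R : realType) (X : normedModType R).
Implicit Types n m : nat.

Lemma le_maxnorm n (z : 'I_n -> X) i : `|z i| <= maxnorm z.
Proof. exact: le_bigmax. Qed.

Lemma maxnorm_ge0 n (z : 'I_n -> X) : 0 <= maxnorm z.
Proof. exact: bigmax_ge_id. Qed.

Lemma maxnorm_le n (z : 'I_n -> X) a :
  0 <= a -> (forall i, `|z i| <= a) -> maxnorm z <= a.
Proof. by move=> a0 H; apply: bigmax_le. Qed.

Lemma maxnorm_lt n (z : 'I_n -> X) a :
  0 < a -> (forall i, `|z i| < a) -> maxnorm z < a.
Proof. by move=> a0 H; apply: bigmax_lt. Qed.

Lemma sublinear_maxnorm n : sublinear (fun z : 'I_n -> X => maxnorm z).
Proof.
have Z t (z : 'I_n -> X) : 0 <= t -> maxnorm (t *: z) <= t * maxnorm z.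
  move=> t0; apply: maxnorm_le => [|i]; first by rewrite mulr_ge0 ?maxnorm_ge0.
  by rewrite normrZ ger0_norm // ler_wpM2l // le_maxnorm.
split=> [x z|t z t0].
  apply: maxnorm_le => [|i]; first by rewrite addr_ge0 ?maxnorm_ge0.
  by apply: le_trans (ler_normD _ _) _; apply: lerD; exact: le_maxnorm.
apply/le_anti; rewrite Z //=; have [->|t1] := eqVneq t 0.
  by rewrite mul0r maxnorm_ge0.
have {t1}t0 : 0 < t by rewrite lt_def t1.
rewrite -ler_pdivlMl //; apply: le_trans (Z _ _ _); last by rewrite invr_ge0 ltW.
by rewrite scalerA mulVf ?gt_eqF // scale1r.
Qed.

Lemma maxnormN n (z : 'I_n -> X) : maxnorm (- z) = maxnorm z.
Proof.
by rewrite /maxnorm; apply: eq_bigr => i _; rewrite -[LHS]/(`|- z i|) normrN.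
Qed.

Lemma maxnorm_distC n (x z : 'I_n -> X) : maxnorm (x - z) = maxnorm (z - x).
Proof. by rewrite -maxnormN opprB. Qed.

Definition single n (i : 'I_n) (x : X) : 'I_n -> X :=
  fun j => if j == i then x else 0.

Lemma maxnorm_single n (i : 'I_n) x : maxnorm (single i x) <= `|x|.
Proof.
by apply: maxnorm_le => // j; rewrite /single; case: eqP => // _; rewrite normr0.
Qed.

Lemma singleD n (i : 'I_n) x z : single i (x + z) = single i x + single i z.
Proof.
apply/funext => j; rewrite -[RHS]/(single i x j + single i z j) /single.
by case: eqP => // _; rewrite addr0.
Qed.

Lemma singleZ n (i : 'I_n) (a : R) x : single i (a *: x) = a *: single i x.
Proof.
apply/funext => j; rewrite -[RHS]/(a *: single i x j) /single.
by case: eqP => // _; rewrite scaler0.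
Qed.

Lemma single_sum n (z : 'I_n -> X) : z = \sum_i single i (z i).
Proof.
apply/funext => j; rewrite fct_sumE (bigD1 j) //= {1}/single eqxx big1 ?addr0 //.
by move=> i; rewrite /single eq_sym => /negPf ->.
Qed.

Lemma linear_form_sum n (P : ('I_n -> X) -> R) z :
  linear_form P -> P z = \sum_i P (single i (z i)).
Proof.
move=> lP; rewrite {1}(single_sum z).
apply: (big_morph P lP.1); exact: linear_form0.
Qed.

End MaxNorm.

Section SeparableReduction.
Variables (R : realType) (X : normedModType R) (n : nat).
Variables (K : countType) (T : Type) (t0 : T) (pts : T -> seq X).
Variables (base : seq X) (Viol : K -> ('I_n -> X) -> T -> Prop).
Hypothesis openViol : forall k u t, Viol k u t ->
  exists2 r : R, 0 < r & forall v, maxnorm (v - u) < r -> Viol k v t.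

Definition seq_closure (c : nat -> X) : set X :=
  [set y | forall e : R, 0 < e -> exists n, `|y - c n| < e].

Lemma invS_lt (e : R) : 0 < e -> exists j : nat, j.+1%:R^-1 < e.
Proof.
move=> e0; exists (Num.truncn e^-1); rewrite -[ltRHS]invrK ltf_pV2 ?posrE ?invr_gt0 //.
exact: truncnS_gt.
Qed.

(** Witnesses range over an arbitrary type, but chosen witnesses are indexed by countable data: an
    index k, a radius 1/(j+1) and a tuple of points of c. The sequence is closed under taking the
    points of these witnesses and under rational linear operations. *)
Lemma separable_reduction : exists c : nat -> X,
  [/\ linear_subspace (seq_closure c), forall x, x \in base -> seq_closure c x &
      forall k u t, (forall i, seq_closure c (u i)) -> Viol k u t ->
        exists2 t', Viol k u t' & forall x, x \in pts t' -> exists i, c i = x].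
Proof.
(* A witness valid on a whole ball remains valid at u when the ball is centred at a nearby tuple of
   points of c. *)
pose P (p : K * nat * ('I_n -> X)) t :=
  forall v, maxnorm (v - p.2) < p.1.2.+1%:R^-1 -> Viol p.1.1 v t.
have [wit witP] : exists wit, forall p t, P p t -> P p (wit p).
  have [p|wit witP] := @choice _ _ (fun p t' => forall t, P p t -> P p t').
    have [[t Pt]|nP] := pselect (exists t, P p t); first by exists t.
    by exists t0 => t Pt; case: nP; exists t.
  by exists wit => p t; exact: witP.
pose op (o : (nat + unit) + (rat + K * nat * nat)) (s : seq X) : X :=
  match o with
  | inl (inl j) => nth 0 base j
  | inl (inr _) => nth 0 s 0 + nth 0 s 1
  | inr (inl q) => ratr q *: nth 0 s 0
  | inr (inr (kj, p)) => nth 0 (pts (wit (kj, fun i : 'I_n => nth 0 s i))) p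
  end.
have [c cP] := countable_closure 0 op.
have c_add i j : exists l, c l = c i + c j by exact: (cP (inl (inr tt)) [:: i; j]).
have c_scale q i : exists l, c l = ratr q *: c i by exact: (cP (inr (inl q)) [:: i]).
have c_in i : seq_closure c (c i) by move=> e e0; exists i; rewrite subrr normr0.
exists c; split.
- split=> [e e0|a x y Yx Yy e e0].
    by have [l cl] := c_scale 0 0%N; exists l; rewrite cl rmorph0 scale0r subrr normr0.
  have e4 : 0 < e / 4 by rewrite divr_gt0.
  have nx1 : 0 < `|x| + 1 by rewrite ltr_wpDl.
  have na2 : 0 < `|a| + 1 by rewrite ltr_wpDl.
  pose s := Num.min 1 (e / 4 / (`|x| + 1)).
  have s0 : 0 < s by rewrite lt_min ltr01 divr_gt0.
  have /rat_in_itvoo[q] : a - s < a + s by lra.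
  rewrite in_itv /= => /andP[q1 q2].
  have aq : `|a - ratr q| < s by rewrite ltr_norml; apply/andP; split; lra.
  have [i ci] := Yx _ (divr_gt0 e4 na2); have [j cj] := Yy _ e4.
  have [l cl] := c_scale q i; have [p cp] := c_add l j; exists p.
  rewrite cp cl.
  have -> : a *: x + y - (ratr q *: c i + c j) =
      (a - ratr q) *: x + ratr q *: (x - c i) + (y - c j).
    by rewrite scalerBl scalerBr !opprD !addrA subrK; congr (_ - _); rewrite addrAC.
  have h1 : `|(a - ratr q) *: x| <= e / 4.
    rewrite normrZ; apply: (@le_trans _ _ (e / 4 / (`|x| + 1) * (`|x| + 1))).
      apply: ler_pM => //; last by rewrite lerDl.
      by apply: le_trans (ltW aq) _; rewrite /s ge_min lexx orbT.
    by rewrite mulfVK ?gt_eqF.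
  have h2 : `|ratr q *: (x - c i)| <= e / 4.
    rewrite normrZ; apply: (@le_trans _ _ ((`|a| + 1) * (e / 4 / (`|a| + 1)))).
      apply: ler_pM => //; last exact: ltW.
      have s1 : s <= 1 by rewrite /s ge_min lexx.
      have := ler_normB a (a - ratr q); rewrite opprB addrC subrK.
      by move: aq; lra.
    by rewrite mulrC mulfVK ?gt_eqF.
  apply: le_lt_trans (ler_normD _ _) _.
  by have := ler_normD ((a - ratr q) *: x) (ratr q *: (x - c i)); lra.
- move=> x /(nthP 0)[j _ <-].
  by have [l cl] := cP (inl (inl j)) [::]; rewrite -[nth 0 base j]cl.
- move=> k u t Yu /openViol[r r0 Hr].
  have r2 : 0 < r / 2 by rewrite divr_gt0.
  have [j jr] := invS_lt r2.
  have j0 : 0 < j.+1%:R^-1 :> R by rewrite invr_gt0.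
  have [s sP] := choice (fun i => Yu i _ j0).
  pose s' := [seq s i | i <- enum 'I_n].
  pose v (i : 'I_n) := nth 0 [seq c i | i <- s'] i.
  have vE i : v i = c (s i).
    by rewrite /v /s' -map_comp (nth_map i) ?size_enum_ord //= nth_ord_enum.
  have vu : maxnorm (v - u) < j.+1%:R^-1.
    by apply: maxnorm_lt => // i; rewrite -[_ i]/(v i - u i) vE distrC.
  (* The small ball around v lies within distance r of u, where t is still a witness, and it
     contains u. *)
  have Pt : P (k, j, v) t.
    move=> y /= yv; apply: Hr.
    have := (sublinear_maxnorm X n).1 (y - v) (v - u).
    rewrite /= addrA subrK => /le_lt_trans; apply.
    have dbl (z : R) : z < r / 2 -> z + z < r by lra.
    exact: lt_trans (ltrD yv vu) (dbl _ jr).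
  exists (wit (k, j, v)).
    by apply: (witP _ _ Pt); rewrite /= maxnorm_distC.
  move=> x /(nthP 0)[p _ <-].
  by have [l cl] := cP (inr (inr (k, j, p))) s'; exists l.
Qed.

End SeparableReduction.

(** * Separating functionals *)

Lemma addrBD (V : zmodType) (x y z t : V) : x - z + (y - t) = x + y - (z + t).
Proof. by rewrite opprD addrACA. Qed.

Section Separators.
Variables (R : realType) (X : normedModType R) (m : nat).
Implicit Types (u v h : 'I_m.+1 -> X) (a g : 'I_m -> X).

Definition diffs h : 'I_m -> X := fun i => h (below i) - h ord_max.

Definition gaps a u : 'I_m -> X := fun i => u ord_max - u (below i) + a i.

Definition extend0 g : 'I_m.+1 -> X :=
  fun j => if unlift ord_max j is Some i then g i else 0.

Lemma below_lift (i : 'I_m) : below i = lift ord_max i.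
Proof. by apply: val_inj; rewrite /= /bump leqNgt ltn_ord. Qed.

Lemma below_eq_max (i : 'I_m) : (below i == ord_max) = false.
Proof. by rewrite below_lift eq_sym; exact/negbTE/neq_lift. Qed.

Lemma extend0_below g i : extend0 g (below i) = g i.
Proof. by rewrite /extend0 below_lift liftK. Qed.

Lemma extend0_max g : extend0 g ord_max = 0.
Proof. by rewrite /extend0 unlift_none. Qed.

Lemma ord_maxP (P : 'I_m.+1 -> Prop) :
  P ord_max -> (forall i, P (below i)) -> forall j, P j.
Proof.
move=> Pm Pb j; case: (unliftP ord_max j) => [i ->|-> //].
by rewrite -below_lift.
Qed.

Lemma extend0B g g' : extend0 g - extend0 g' = extend0 (g - g').
Proof.
apply/funext; apply: ord_maxP => [|i].
  by rewrite -[LHS]/(extend0 g ord_max - extend0 g' ord_max) !extend0_max subr0.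
by rewrite -[LHS]/(extend0 g (below i) - extend0 g' (below i)) !extend0_below.
Qed.

Lemma maxnorm_extend0 g : maxnorm (extend0 g) <= maxnorm g.
Proof.
apply: maxnorm_le; first exact: maxnorm_ge0.
apply: ord_maxP => [|i]; first by rewrite extend0_max normr0 maxnorm_ge0.
by rewrite extend0_below le_maxnorm.
Qed.

Lemma diffs_extend0 g : diffs (extend0 g) = g.
Proof. by apply/funext => i; rewrite /diffs extend0_below extend0_max subr0. Qed.

Lemma diffsD h v : diffs (h + v) = diffs h + diffs v.
Proof. by apply/funext => i; rewrite /diffs opprD addrACA. Qed.

Lemma diffsZ (t : R) h : diffs (t *: h) = t *: diffs h.
Proof. by apply/funext => i; rewrite /diffs -scalerBr. Qed.

Lemma diffsN h : diffs (- h) = - diffs h.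
Proof. by rewrite -scaleN1r diffsZ scaleN1r. Qed.

Lemma diffsB h v : diffs (h - v) = diffs h - diffs v.
Proof. by rewrite diffsD diffsN. Qed.

Lemma maxnorm_diffs h : maxnorm (diffs h) <= 2 * maxnorm h.
Proof.
apply: maxnorm_le => [|i]; first by rewrite mulr_ge0 ?maxnorm_ge0.
have := le_maxnorm h (below i); have := le_maxnorm h ord_max.
have := ler_normB (h (below i)) (h ord_max); rewrite /diffs; lra.
Qed.

Lemma maxnorm_le_diffs h : maxnorm h <= `|h ord_max| + maxnorm (diffs h).
Proof.
apply: maxnorm_le; first by rewrite addr_ge0 ?maxnorm_ge0.
apply: ord_maxP => [|i]; first by rewrite lerDl maxnorm_ge0.
have := le_maxnorm (diffs h) i; have := ler_normD (diffs h i) (h ord_max).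
by rewrite /diffs subrK; lra.
Qed.

Lemma gaps_add a u h : gaps a (u + h) = gaps a u - diffs h.
Proof.
apply/funext => i; rewrite -[RHS]/(gaps a u i - diffs h i) /gaps /diffs.
have E j : (u + h) j = u j + h j by [].
by rewrite !E opprB opprD addrACA [LHS]addrAC.
Qed.

Lemma gapsB a u v : gaps a v - gaps a u = - diffs (v - u).
Proof.
by rewrite -[in gaps a v](subrK u v) [v - u + u]addrC gaps_add addrAC subrr add0r.
Qed.

Lemma maxnorm_gaps_lip a u v :
  maxnorm (gaps a v) - maxnorm (gaps a u) <= 2 * maxnorm (v - u).
Proof.
have := (sublinear_maxnorm X m).1 (gaps a v - gaps a u) (gaps a u).
rewrite subrK /= gapsB maxnormN; have := maxnorm_diffs (v - u); lra.
Qed.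

Variables (Omega : 'I_m.+1 -> set X) (a : 'I_m -> X) (al : R).
Hypotheses (al0 : 0 < al) (al1 : al < 1).

(* A functional (P_1, ..., P_n) on X^n is dominated by fuzzy_norm iff
   |P_1 + ... + P_n| <= al and |P_1| + ... + |P_(n-1)| <= 1 + al. *)
Definition fuzzy_norm h := al * `|h ord_max| + (1 + al) * maxnorm (diffs h).

Lemma fuzzy_norm_ge0 h : 0 <= fuzzy_norm h.
Proof. by rewrite addr_ge0 // mulr_ge0 ?maxnorm_ge0 ?addr_ge0 // ltW. Qed.

Lemma sublinear_fuzzy_norm : sublinear fuzzy_norm.
Proof.
have [sD sZ] := sublinear_maxnorm X m.
have al2 : 0 < 1 + al by rewrite addr_gt0.
split=> [x z|t x t0]; rewrite /fuzzy_norm.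
  have h1 : al * `|(x + z) ord_max| <= al * (`|x ord_max| + `|z ord_max|).
    by rewrite ler_pM2l //; exact: ler_normD.
  have h2 : (1 + al) * maxnorm (diffs (x + z)) <=
      (1 + al) * (maxnorm (diffs x) + maxnorm (diffs z)).
    by rewrite ler_pM2l // diffsD; exact: sD.
  lra.
rewrite diffsZ [maxnorm _](sZ t _ t0).
by rewrite -[(t *: x) _]/(t *: x _) normrZ ger0_norm //=; lra.
Qed.

Lemma fuzzy_norm_le h : fuzzy_norm h <= 5 * maxnorm h.
Proof.
have h1 : al * `|h ord_max| <= 1 * maxnorm h.
  by apply: ler_pM => //; [exact: ltW|exact: ltW|exact: le_maxnorm].
have h2 : (1 + al) * maxnorm (diffs h) <= 2 * (2 * maxnorm h).
  apply: ler_pM => //; last exact: maxnorm_diffs.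
  - by rewrite addr_ge0 // ltW.
  - exact: maxnorm_ge0.
  - by move: al1; lra.
by rewrite /fuzzy_norm; lra.
Qed.

(** The last clause bounds the sum of the first n - 1 norms below by 1 - 2 al and becomes the
    tau-inequality after normalization. *)
Definition quasi_separator u (P : ('I_m.+1 -> X) -> R) :=
  [/\ linear_form P, forall h, P h <= fuzzy_norm h &
      (1 - 2 * al) * maxnorm (gaps a u) <= P (extend0 (gaps a u))].

Definition separator u P := quasi_separator u P /\
  forall i (e : R), 0 < e -> exists2 d : R, 0 < d & forall w, Omega i w ->
    `|w - u i| < d -> P (single i (w - u i)) <= e * `|w - u i|.

(** An index i, a point w of [Omega i], a number j standing for the accuracy 1/(j+1), and the
    coefficient of the secant vector from u i to w. *)
Definition item : Type := 'I_m.+1 * X * nat * R.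

(** The constraint P (vec) <= cost is the conic combination of the normality constraints with
    coefficients from s and of the gap constraint with multiplier mu. *)
Definition vec u (s : seq item) (mu : R) : 'I_m.+1 -> X :=
  \sum_(x <- s) x.2 *: single x.1.1.1 (x.1.1.2 - u x.1.1.1) -
    mu *: extend0 (gaps a u).

Definition cost u (s : seq item) (mu : R) : R :=
  \sum_(x <- s) x.2 * (x.1.2.+1%:R^-1 * `|x.1.1.2 - u x.1.1.1|) -
    mu * ((1 - 2 * al) * maxnorm (gaps a u)).

Definition admissible (k : seq nat) u (x : item) :=
  [/\ Omega x.1.1.1 x.1.1.2, (x.1.2 < size k)%N,
      `|x.1.1.2 - u x.1.1.1| < (nth 0%N k x.1.2).+1%:R^-1 & 0 <= x.2].

(* An obstruction at u to the existence of a separator; k records the radii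
   demanded for finitely many of the accuracies 1, 1/2, 1/3, ... *)
Definition obstruction (k : seq nat) u (t : seq item * R) :=
  [/\ forall x, List.In x t.1 -> admissible k u x, 0 <= t.2 &
      fuzzy_norm (- vec u t.1 t.2) + cost u t.1 t.2 < 0].

(** The combined constraints form a convex cone, and an obstruction is exactly a failure of its
    compatibility with [fuzzy_norm]. Each combination uses finitely many accuracies, so a prefix of
    delta suffices. *)
Lemma separator_of_no_obstruction u (delta : nat -> nat) :
  (forall J t, ~ obstruction (mkseq delta J) u t) -> exists P, separator u P.
Proof.
move=> nob.
pose G v r := exists J s mu, [/\
  forall x, List.In x s -> admissible (mkseq delta J) u x,
  0 <= mu, v = vec u s mu & r = cost u s mu].
have cG : convex_cone G.
  split.
  - exists 0%N, [::], 0; split=> //; first by rewrite /vec big_nil scale0r subr0.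
    by rewrite /cost big_nil mul0r subr0.
  - move=> v w r r' [J [s [mu [As mu0 -> ->]]]] [J' [s' [mu' [As' mu'0 -> ->]]]].
    exists (maxn J J'), (s ++ s'), (mu + mu'); split.
    + have mono K L x : (K <= L)%N -> admissible (mkseq delta K) u x ->
          admissible (mkseq delta L) u x.
        move=> KL [wO jK xu x0]; rewrite size_mkseq in jK; split=> //.
          by rewrite size_mkseq (leq_trans jK).
        by move: xu; rewrite !nth_mkseq // (leq_trans jK).
      move=> x xs; case: (List.in_app_or _ _ _ xs) => ys.
        exact: (mono _ _ _ (leq_maxl _ _) (As _ ys)).
      exact: (mono _ _ _ (leq_maxr _ _) (As' _ ys)).
    + exact: addr_ge0.
    + by rewrite /vec big_cat /= scalerDl; exact: addrBD.
    + by rewrite /cost big_cat /= (mulrDl mu); exact: addrBD.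
  - move=> t v r t0 [J [s [mu [As mu0 -> ->]]]].
    exists J, [seq (x.1, t * x.2) | x <- s], (t * mu); split.
    + move=> x /List.in_map_iff[y [<- /As[wO jJ yu y0]]].
      by split=> //=; exact: mulr_ge0.
    + exact: mulr_ge0.
    + rewrite /vec big_map scalerBr scalerA scaler_sumr; congr (_ - _).
      by apply: eq_bigr => x _; rewrite scalerA.
    + rewrite /cost big_map mulrBr mulrA mulr_sumr; congr (_ - _).
      by apply: eq_bigr => x _; rewrite mulrA.
have [|P [lP Pq PG]] := sandwich sublinear_fuzzy_norm cG.
  move=> v r [J [s [mu [As mu0 -> ->]]]]; rewrite leNgt; apply/negP => lt0.
  by apply: (nob J (s, mu)).
exists P; split.
  split=> //; have := PG (- extend0 (gaps a u)) (- ((1 - 2 * al) * maxnorm (gaps a u))).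
  rewrite (linear_formN _ lP) lerN2; apply; exists 0%N, [::], 1; split=> //.
    by rewrite /vec big_nil sub0r scale1r.
  by rewrite /cost big_nil sub0r mul1r.
move=> i e e0; have [j je] := invS_lt e0.
exists ((delta j).+1%:R^-1) => // w Ow wd.
apply: (@le_trans _ _ (j.+1%:R^-1 * `|w - u i|)); last by rewrite ler_wpM2r // ltW.
apply: PG; exists j.+1, [:: (i, w, j, 1)], 0; split=> //.
- move=> x [<-|//]; split=> //; first by rewrite size_mkseq.
  by rewrite nth_mkseq.
- by rewrite /vec big_seq1 /= scale1r scale0r subr0.
- by rewrite /cost big_seq1 /= mul1r mul0r subr0.
Qed.

Lemma no_obstruction (Y : set X) k u P t : quasi_separator u P ->
  (forall j i w, (j < size k)%N -> Omega i w -> Y w ->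
    `|w - u i| < (nth 0%N k j).+1%:R^-1 ->
    P (single i (w - u i)) <= j.+1%:R^-1 * `|w - u i|) ->
  (forall x, List.In x t.1 -> Y x.1.1.2) -> ~ obstruction k u t.
Proof.
move=> [lP Pq Pgap] PY; case: t => s mu /= Ys [/= As mu0].
apply/negP; rewrite -leNgt.
suff : P (vec u s mu) <= cost u s mu.
  by have := Pq (- vec u s mu); rewrite (linear_formN _ lP); lra.
rewrite /vec /cost (linear_formB _ _ lP) lP.2; apply: lerB; last by rewrite ler_wpM2l.
elim: s As Ys => [|x s IH] As Ys; first by rewrite !big_nil (linear_form0 lP).
rewrite !big_cons lP.1 lP.2; apply: lerD.
  have [wO jk xu x0] := As x (or_introl erefl).
  by rewrite ler_wpM2l //; apply: PY => //; apply: Ys; left.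
by apply: IH => y ys; [apply: As|apply: Ys]; right.
Qed.

(** Finitely many strict inequalities are involved, and [vec] and [cost] are Lipschitz in u for
    fixed items. *)
Lemma obstruction_open k u t : obstruction k u t ->
  exists2 r : R, 0 < r & forall v, maxnorm (v - u) < r -> obstruction k v t.
Proof.
case: t => s mu [/= As mu0 val].
have [r r0 Hr] : exists2 r : R, 0 < r & forall v, maxnorm (v - u) < r ->
    forall x, List.In x s -> admissible k v x.
  elim: s {val} As => [|x s IH] As; first by exists 1.
  have [|r r0 Hr] := IH; first by move=> y ys; apply: As; right.
  have [wO jk xu x0] := As x (or_introl erefl).
  exists (Num.min r ((nth 0%N k x.1.2).+1%:R^-1 - `|x.1.1.2 - u x.1.1.1|)).
    by rewrite lt_min r0 subr_gt0.
  move=> v; rewrite lt_min => /andP[vr vx] y [<-|]; last exact: Hr.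
  split=> //; have := ler_distD (u x.1.1.1) x.1.1.2 (v x.1.1.1).
  move=> /le_lt_trans; apply; rewrite -ltrBrDl; apply: le_lt_trans vx.
  by rewrite distrC; exact: (le_maxnorm (v - u)).
have [C C0 HC] : exists2 C : R, 0 <= C & forall v,
    maxnorm (vec v s mu - vec u s mu) <= C * maxnorm (v - u) /\
    cost v s mu - cost u s mu <= C * maxnorm (v - u).
  elim: s {val r r0 Hr} As => [|x s IH] As.
    exists (2 * mu) => [|v]; first by rewrite mulr_ge0.
    rewrite /vec /cost !big_nil !sub0r !opprK; split.
      rewrite addrC -scalerBr extend0B [maxnorm _](sublinear_maxnorm _ _).2 //.
      rewrite -mulrA mulrCA ler_wpM2l //.
      apply: le_trans (maxnorm_extend0 _) _.
      by rewrite gapsB maxnormN -[in leRHS]maxnormN opprB; exact: maxnorm_diffs.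
    have h := maxnorm_gaps_lip a v u.
    have h' := maxnorm_gaps_lip a u v.
    set gv := maxnorm (gaps a v) in h h' *; set gu := maxnorm (gaps a u) in h h' *.
    have -> : - (mu * ((1 - 2 * al) * gv)) + mu * ((1 - 2 * al) * gu) =
        mu * ((1 - 2 * al) * (gu - gv)) by ring.
    rewrite [2 * mu]mulrC -[leRHS]mulrA ler_wpM2l //.
    have ab : `|1 - 2 * al| <= 1 by rewrite ler_norml; move: al0 al1; lra.
    apply: le_trans (ler_norm _) _; rewrite normrM -[leRHS]mul1r.
    apply: ler_pM => //; rewrite maxnorm_distC in h.
    by rewrite ler_norml; lra.
  have [|C C0 HC] := IH; first by move=> y ys; apply: As; right.
  have [wO jk xu x0] := As x (or_introl erefl).
  exists (C + x.2) => [|v]; first exact: addr_ge0.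
  have [h1 h2] := HC v.
  have vecE w : vec w (x :: s) mu =
      x.2 *: single x.1.1.1 (x.1.1.2 - w x.1.1.1) + vec w s mu.
    by rewrite /vec big_cons addrA.
  have costE w : cost w (x :: s) mu =
      x.2 * (x.1.2.+1%:R^-1 * `|x.1.1.2 - w x.1.1.1|) + cost w s mu.
    by rewrite /cost big_cons addrA.
  have uv := le_maxnorm (v - u) x.1.1.1; rewrite -[(v - u) _]/(v _ - u _) in uv.
  split.
    rewrite !vecE opprD addrACA -scalerBr.
    apply: le_trans ((sublinear_maxnorm _ _).1 _ _) _.
    rewrite /= mulrDl [leRHS]addrC; apply: lerD => //.
    rewrite [maxnorm _](sublinear_maxnorm _ _).2 // ler_wpM2l //.
    rewrite -[single _ _ - _]/(single _ _ + - single _ _).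
    rewrite -[- single _ (_ - u _)]scaleN1r -singleZ -singleD scaleN1r.
    apply: le_trans (maxnorm_single _ _) _.
    by rewrite opprB addrC addrA subrK -opprB normrN.
  rewrite !costE opprD addrACA mulrDl [leRHS]addrC; apply: lerD => //.
  rewrite -mulrBr ler_wpM2l // -mulrBr.
  apply: le_trans (ler_norm _) _; rewrite normrM -[leRHS]mul1r.
  apply: ler_pM => //; first by rewrite ger0_norm // invf_le1 // ler1n.
  apply: le_trans uv; apply: le_trans (ler_dist_dist _ _) _.
  by rewrite opprB addrC addrA subrK -opprB normrN.
pose val0 := fuzzy_norm (- vec u s mu) + cost u s mu.
(* Of 6 C, 5 C comes from [fuzzy_norm] by [fuzzy_norm_le] and C from [cost]; the 1 keeps the divisor
   positive. *)
have D0 : 0 < 6 * C + 1 by rewrite ltr_wpDl // mulr_ge0.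
exists (Num.min r (- val0 / (6 * C + 1))).
  by rewrite lt_min r0 divr_gt0 // oppr_gt0.
move=> v; rewrite lt_min => /andP[vr vval]; split=> //=; first exact: Hr.
have [h1 h2] := HC v.
have := sublinear_fuzzy_norm.1 (- vec v s mu + vec u s mu) (- vec u s mu).
rewrite addrK; have := fuzzy_norm_le (- vec v s mu + vec u s mu).
have -> : maxnorm (- vec v s mu + vec u s mu) = maxnorm (vec v s mu - vec u s mu).
  by rewrite addrC maxnorm_distC.
move=> h3 h4.
move: vval; rewrite ltr_pdivlMr // /val0 => vval.
by have := maxnorm_ge0 (v - u); move: vval; rewrite mulrDr mulr1; lra.
Qed.

(** The functional P may depend on J and is tested only at points of the separable subspace, yet a
    separator on all of X follows. *)
Lemma separator_reduction (base : seq X) : exists c : nat -> X,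
  [/\ linear_subspace (seq_closure c), forall x, x \in base -> seq_closure c x &
    forall u (delta : nat -> nat), (forall i, seq_closure c (u i)) ->
      (forall J, exists P, quasi_separator u P /\
        forall j i w, (j < J)%N -> Omega i w -> seq_closure c w ->
          `|w - u i| < (delta j).+1%:R^-1 ->
          P (single i (w - u i)) <= j.+1%:R^-1 * `|w - u i|) ->
      exists P, separator u P].
Proof.
pose pts (t : seq item * R) := [seq x.1.1.2 | x <- t.1].
have [c [sY Yb red]] := separable_reduction ([::], 0) pts base obstruction_open.
exists c; split=> // u delta Yu HJ; apply: (@separator_of_no_obstruction u delta).
move=> J t /(red _ _ _ Yu)[t' ob' Yt'].
have [P [qP PY]] := HJ J.
apply: (no_obstruction (Y := seq_closure c) qP _ _ ob').
  move=> j i w; rewrite size_mkseq => jJ; rewrite nth_mkseq //; exact: PY.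
move=> x xt e e0.
have [|n cn] := Yt' x.1.1.2; last by exists n; rewrite cn subrr normr0.
rewrite /pts; elim: t'.1 xt => //= y s IH [->|/IH ys]; first by rewrite mem_head.
by rewrite in_cons ys orbT.
Qed.

End Separators.

(** * Completeness of products and smoothing of the maximum norm *)

Section Existence.
Variables (R : realType) (X : completeNormedModType R).

Lemma seq_closureE (c : nat -> X) : seq_closure c = closure (range c).
Proof.
apply/seteqP; split=> y.
  move=> Yy B /nbhs_ballP[e /= e0 eB]; have [n yn] := Yy e e0.
  by exists (c n); split; [exists n|apply: eB; rewrite -ball_normE].
move=> Cy e e0; have [_ [[n _ <-] yn]] := Cy _ (nbhsx_ballx y e e0).
by exists n; rewrite -ball_normE in yn.
Qed.

Lemma complete_box n (F : 'I_n -> set X) (u : nat -> 'I_n -> X) :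
  (forall i, closed (F i)) -> (forall k, forall i, F i (u k i)) ->
  (forall e : R, 0 < e -> exists k, forall i j, (k <= i)%N -> (k <= j)%N ->
    maxnorm (u i - u j) < e) ->
  exists x, (forall i, F i (x i)) /\ forall e : R, 0 < e ->
    exists k, forall i, (k <= i)%N -> maxnorm (u i - x) < e.
Proof.
move=> cF Fu cu.
have cui i : cvgn (fun k => u k i).
  apply: cauchy_seq_cvg => e e0; have [k Hk] := cu e e0.
  exists k => p q kp kq; apply: le_lt_trans (Hk p q kp kq).
  exact: (le_maxnorm (u p - u q) i).
pose x i := limn (fun k => u k i).
exists x; split=> [i|e e0].
  by apply: (closed_cvg (F i) _ _ _ (cui i)) => //; exact: nearW.
have : \forall k \near \oo, forall i, `|u k i - x i| < e.
  apply: filter_forall => i.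
  by have /cvgrPdistC_lt/(_ e e0) : (fun k => u k i) @ \oo --> x i := cui i.
move=> [k _ Hk]; exists k => j kj; apply: maxnorm_lt => // i.
exact: (Hk j kj i).
Qed.

Section Smooth.
Variables (c : nat -> X) (aX : Asplund X) (sY : linear_subspace (seq_closure c)).
Let Y := seq_closure c.

Lemma smooth_maxnorm n (kappa : R) : 0 < kappa ->
  exists h : ('I_n -> X) -> R,
  [/\ forall z, maxnorm z - kappa <= h z, forall z, h z <= maxnorm z,
      forall x z, h x - h z <= maxnorm (x - z) &
      forall y, (forall i, Y (y i)) -> exists l,
        [/\ linear_form l, forall z, l z <= maxnorm z, h y <= l y &
        forall e, 0 < e -> exists2 r, 0 < r & forall k, (forall i, Y (k i)) ->
          maxnorm k < r -> h (y + k) <= h y + l k + e * maxnorm k]].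
Proof.
move=> k0.
have Yc k : Y (c k) by move=> e e0; exists k; rewrite subrr normr0.
have [d [cd dd]] := dual_separable aX sY Yc (fun y e (Yy : Y y) => Yy e).
pose code k := odflt [ffun=> 0%N] (unpickle k : option {ffun 'I_n -> nat}).
have codeK g : code (pickle g) = g by rewrite /code pickleK.
pose cV k : 'I_n -> X := fun i => c (code k i).
pose dV k (z : 'I_n -> X) := \sum_i d (code k i) (z i).
have sW : linear_subspace [set z : 'I_n -> X | forall i, Y (z i)].
  by split=> [i|a x y Yx Yy i]; [exact: sY.1|exact: (sY.2 a _ _ (Yx i) (Yy i))].
have := @smooth_approximation _ _ _ _ (sublinear_maxnorm X n) (@maxnormN _ _ n)
  sW cV _ _ dV n%:R _ _ _ _ kappa k0.
apply.
- by move=> k i; exact: Yc.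
- move=> y e Yy e0; have [g gP] := choice (fun i => Yy i e e0).
  exists (pickle (finfun g)); apply: maxnorm_lt => // i.
  by rewrite -[_ i]/(y i - cV _ i) /cV codeK ffunE.
- by rewrite ler0n.
- move=> k; split=> [x y|a x]; rewrite /dV.
    by rewrite -big_split; apply: eq_bigr => i _; exact: (cd _).1.1.
  by rewrite mulr_sumr; apply: eq_bigr => i _; exact: (cd _).1.2.
- move=> k x; rewrite /dV mulr_natl -[X in _ *+ X]card_ord -sumr_const.
  by apply: ler_sum => i _; apply: le_trans ((cd _).2 _) _; exact: le_maxnorm.
- move=> f e [lf fN] e0.
  have cf i : unit_form (fun x => f (single i x)).
    split; first by split=> [x y|a x]; rewrite (singleD, singleZ) (lf.1, lf.2).
    by move=> x; apply: le_trans (fN _) _; exact: maxnorm_single.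
  (* Dividing e by n + 1 instead of n also covers n = 0. *)
  have n1 : 0 < n.+1%:R :> R by [].
  have [g gP] := choice (fun i => dd _ _ (cf i) (divr_gt0 e0 n1)).
  exists (pickle (finfun g)) => z Yz.
  rewrite (linear_form_sum _ lf) /dV codeK -sumrB.
  apply: le_trans (ler_norm_sum _ _ _) _.
  apply: (@le_trans _ _ (\sum_(i < n) e / n.+1%:R * maxnorm z)).
    apply: ler_sum => i _; rewrite ffunE; apply: le_trans (gP i _ (Yz i)) _.
    by rewrite ler_wpM2l ?le_maxnorm // divr_ge0 // ltW.
  rewrite sumr_const card_ord -[leLHS]mulr_natl mulrA ler_wpM2r ?maxnorm_ge0 //.
  rewrite mulrCA ler_piMr ?(ltW e0) // ler_pdivrMr // mul1r ler_nat.
  exact: leqnSn.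
Qed.

End Smooth.

End Existence.

(** * The convex case *)

Lemma convex_combination (R : realType) (X : lmodType R) (A : set X) x y (t : R) :
  convex_set (A : set (convex_lmodType X)) -> A x -> A y -> 0 <= t -> t <= 1 ->
  A (t *: x + (1 - t) *: y).
Proof.
move=> cA Ax Ay t0 t1.
by have := cA x y (Itv01 t0 t1) (mem_set Ax) (mem_set Ay); rewrite inE.
Qed.

Section Separation.
Variables (R : realType) (X : completeNormedModType R) (m : nat).
Variables (Omega : 'I_m.+1 -> set X) (a : 'I_m -> X) (al : R).
Hypothesis al0 : 0 < al.

(** The constraint cone consists of feasible directions g and multiples of the gap vector. Its
    compatibility with [fuzzy_norm] comes from moving u slightly along g: for h = mu (gap, 0) - g,
    minimality yields mu M <= |diffs h| + al |g|, and |g| <= |g_n| + mu M + |diffs h| turns this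
    into (1 - al) mu M <= [fuzzy_norm h]. *)
Lemma convex_separator u :
  (forall i, convex_set (Omega i : set (convex_lmodType X))) ->
  (forall i, Omega i (u i)) ->
  (forall z, (forall i, Omega i (z i)) ->
    maxnorm (gaps a u) <= maxnorm (gaps a z) + al * maxnorm (z - u)) ->
  exists P, separator Omega a al u P.
Proof.
move=> cO Ou umin; set M := maxnorm (gaps a u) in umin *.
pose dir g := exists2 t0 : R, 0 < t0 & forall t, 0 < t -> t <= t0 ->
  forall i, Omega i (u i + t *: g i).
pose G v r := exists g mu, [/\ dir g, 0 <= mu,
  v = g - mu *: extend0 (gaps a u) & r = - (mu * ((1 - 2 * al) * M))].
have cG : convex_cone G.
  split.
  - exists 0, 0; split=> //; last by rewrite mul0r oppr0.
      by exists 1 => // t t0 t1 i; rewrite -[0 i]/(0 : X) scaler0 addr0.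
    by rewrite scale0r subr0.
  - move=> v w r s [g [mu [[t t0 gP] mu0 -> ->]]] [g' [mu' [[t' t'0 gP'] mu'0 -> ->]]].
    exists (g + g'), (mu + mu'); split.
    (* A step along g + g' is the midpoint of doubled steps along g and g'. *)
    + exists (Num.min t t' / 2); first by rewrite divr_gt0 // lt_min t0.
      move=> p p0 pt i.
      have pm : p * 2 <= Num.min t t' by rewrite -ler_pdivlMr.
      have p2 : 0 < p * 2 by rewrite mulr_gt0.
      move: pm; rewrite le_min => /andP[pt1 pt2].
      have h1 := gP _ p2 pt1 i; have h2 := gP' _ p2 pt2 i.
      have half0 : 0 <= 2^-1 :> R by rewrite invr_ge0.
      have half1 : 2^-1 <= 1 :> R by rewrite invf_le1 // ler1n.
      have := convex_combination (cO i) h1 h2 half0 half1.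
      have -> : 1 - 2^-1 = 2^-1 :> R by lra.
      rewrite -[(g + g') i]/(g i + g' i) !scalerDr !scalerA addrACA -scalerDl.
      have -> : 2^-1 * (p * 2) = p by rewrite mulrC mulfK.
      have -> : 2^-1 + 2^-1 = 1 :> R by lra.
      by rewrite scale1r.
    + exact: addr_ge0.
    + by rewrite scalerDl; exact: addrBD.
    + by rewrite (mulrDl mu) opprD.
  - move=> t v r t0 [g [mu [[s s0 gP] mu0 -> ->]]].
    exists (t *: g), (t * mu); split.
    + have t1 : 0 < t + 1 by rewrite ltr_wpDl.
      exists (s / (t + 1)); first by rewrite divr_gt0.
      move=> p p0 ps i; rewrite -[(t *: g) i]/(t *: g i) scalerA.
      have [->|tn0] := eqVneq t 0; first by rewrite mulr0 scale0r addr0.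
      have t0' : 0 < t by rewrite lt_def tn0.
      apply: gP; first exact: mulr_gt0.
      apply: (@le_trans _ _ (p * (t + 1))); last by rewrite -ler_pdivlMr.
      by rewrite ler_pM2l // lerDl.
    + exact: mulr_ge0.
    + by rewrite scalerBr scalerA.
    + by rewrite mulrN mulrA.
have [|P [lP Pq PG]] := sandwich (sublinear_fuzzy_norm X m al0) cG.
  move=> v r [g [mu [[t0 t00 gP] mu0 -> ->]]].
  rewrite opprB; set h := _ - g.
  have q0 := fuzzy_norm_ge0 al0 h.
  move: mu0; rewrite le_eqVlt => /predU1P[<-|mu0]; first by rewrite mul0r oppr0 addr0.
  have hmax : `|h ord_max| = `|g ord_max|.
    rewrite /h -[(_ - g) _]/(mu *: extend0 _ _ - g _) extend0_max scaler0 sub0r.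
    exact: normrN.
  have hd : diffs h = mu *: gaps a u - diffs g.
    by rewrite /h diffsB diffsZ diffs_extend0.
  set Q := maxnorm (diffs h).
  have [sD sZ] := sublinear_maxnorm X m.
  have Ng : maxnorm g <= `|g ord_max| + (mu * M + Q).
    apply: le_trans (maxnorm_le_diffs g) _; rewrite lerD2l.
    have -> : diffs g = mu *: gaps a u - diffs h by rewrite hd opprB addrC subrK.
    apply: le_trans (sD _ _) _; rewrite /= maxnormN lerD2r.
    by rewrite [maxnorm _](sZ _ _ (ltW mu0)).
  (* With t mu <= 1, the new gap is a combination of the old gap and [diffs h] with nonnegative
     coefficients. *)
  pose t := Num.min t0 mu^-1.
  have tp : 0 < t by rewrite lt_min t00 invr_gt0.
  have tmu : t * mu <= 1.
    by rewrite -ler_pdivlMr // mul1r /t ge_min lexx orbT.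
  have tt0 : t <= t0 by rewrite /t ge_min lexx.
  have := umin (u + t *: g) (gP t tp tt0); rewrite addrAC subrr add0r.
  have -> : maxnorm (t *: g) = t * maxnorm g.
    exact: (sublinear_maxnorm X m.+1).2 _ _ (ltW tp).
  rewrite gaps_add diffsZ.
  have -> : gaps a u - t *: diffs g = (1 - t * mu) *: gaps a u + t *: diffs h.
    have E (W : lmodType R) (x y : W) :
        x - t *: y = (1 - t * mu) *: x + t *: (mu *: x - y).
      by rewrite scalerBr scalerA scalerBl scale1r addrA subrK.
    by rewrite hd; exact: E.
  have h1 : maxnorm ((1 - t * mu) *: gaps a u + t *: diffs h) <=
      (1 - t * mu) * M + t * Q.
    apply: le_trans (sD _ _) _; rewrite /= [maxnorm (t *: _)](sZ _ _ (ltW tp)).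
    by rewrite lerD2r [maxnorm _](sZ (1 - t * mu)) // subr_ge0.
  move=> h2; have h3 : t * (mu * M) <= t * (Q + al * maxnorm g) by lra.
  rewrite ler_pM2l // in h3.
  have h4 : al * maxnorm g <= al * (`|g ord_max| + (mu * M + Q)) by rewrite ler_pM2l.
  have h5 : 0 <= al * (mu * M).
    by rewrite mulr_ge0 ?(ltW al0) // mulr_ge0 ?maxnorm_ge0 // ltW.
  by rewrite /fuzzy_norm hmax -/Q; lra.
exists P; split.
  split=> //; have := PG (- extend0 (gaps a u)) (- ((1 - 2 * al) * maxnorm (gaps a u))).
  rewrite (linear_formN _ lP) lerN2; apply.
  exists 0, 1; split=> //; last by rewrite mul1r.
    by exists 1 => // t t0 t1 i; rewrite -[0 i]/(0 : X) scaler0 addr0.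
  by rewrite sub0r scale1r.
move=> i e e0; exists 1 => // w Ow _.
apply: (@le_trans _ _ 0); last by rewrite mulr_ge0 // ltW.
apply: PG; exists (single i (w - u i)), 0; split=> //.
(* By convexity the whole segment from u i to w is feasible, so P is nonpositive on the secant
   vector. *)
- exists 1 => // t t0 t1 j; rewrite /single; case: eqP => [->|_]; last first.
    by rewrite scaler0 addr0.
  have := convex_combination (cO i) Ow (Ou i) (ltW t0) t1.
  by rewrite scalerBl scale1r scalerBr addrCA.
- by rewrite scale0r subr0.
- by rewrite mul0r oppr0.
Qed.

End Separation.

(** * The Asplund case *)

Lemma sum_Frechet (R : realType) (V : lmodType R) (N : V -> R) (W : set V)
    (H : nat -> V -> R) (l : nat -> V -> R) (x : nat -> V) (w : nat -> R) :
  (forall k, 0 <= N k) -> (forall j, 0 <= w j) ->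
  (forall j e, 0 < e -> exists2 r, 0 < r & forall k, W k -> N k < r ->
    H j (x j + k) <= H j (x j) + l j k + e * N k) ->
  forall K e, 0 < e -> exists2 r, 0 < r & forall k, W k -> N k < r ->
    \sum_(j < K) w j * H j (x j + k) <=
    \sum_(j < K) w j * H j (x j) + \sum_(j < K) w j * l j k + e * N k.
Proof.
move=> N0 w0 dH; elim=> [|K IH] e e0.
  by exists 1 => // k _ _; rewrite !big_ord0 !add0r mulr_ge0 // ltW.
have e2 : 0 < e / 2 by rewrite divr_gt0.
have wK : 0 < w K + 1 by rewrite ltr_wpDl.
have [r1 r10 H1] := IH _ e2; have [r2 r20 H2] := dH K _ (divr_gt0 e2 wK).
exists (Num.min r1 r2); first by rewrite lt_min r10.
move=> k Wk; rewrite lt_min => /andP[kr1 kr2]; rewrite !big_ord_recr /=.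
have h1 := H1 k Wk kr1; have h2 := ler_wpM2l (w0 K) (H2 k Wk kr2).
have h3 : w K * (e / 2 / (w K + 1) * N k) <= e / 2 * N k.
  rewrite mulrA ler_wpM2r // mulrCA ler_piMr ?(ltW e2) //.
  by rewrite ler_pdivrMr // mul1r lerDl.
by move: h2; rewrite !mulrDr; lra.
Qed.

Section AsplundSeparation.
Variables (R : realType) (X : completeNormedModType R) (m : nat).
Variables (Omega : 'I_m.+1 -> set X) (a : 'I_m -> X) (al r rho : R) (xbar : X).
Hypotheses (al0 : 0 < al) (al1 : al < 1) (r0 : 0 < r) (rho0 : 0 < rho).
Hypothesis Omega_closed : forall i, closed (Omega i).
Hypothesis Omega_xbar : forall i, Omega i xbar.
Hypothesis gaps_ge : forall z, (forall i, Omega i (z i)) -> rho <= maxnorm (gaps a z).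
(** Half of the slack al r / 16 in the variational principle; the smoothing error kappa takes the
    other half. *)
Hypothesis a_le : maxnorm a <= al * r / 32.

Let w j : R := al * 2^-1 ^+ j.+1.

Let w0 j : 0 < w j. Proof. by rewrite mulr_gt0 // exprn_gt0. Qed.

(* Partial sums avoid the limit functional: grad_diff bounds the tails. *)
Let grad (l : ('I_m -> X) -> R) (ls : nat -> ('I_m.+1 -> X) -> R) K v : R :=
  l (diffs v) - \sum_(j < K) w j * ls j v.

Let grad_diff l ls K L v : (forall j, linear_form (ls j)) ->
  (forall j z, ls j z <= maxnorm z) -> (K <= L)%N ->
  grad l ls L v <= grad l ls K v + al * 2^-1 ^+ K * maxnorm v.
Proof.
move=> lls lsN KL.
suff : grad l ls L v <= grad l ls K v + (al * 2^-1 ^+ K - al * 2^-1 ^+ L) * maxnorm v.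
  have : 0 <= al * 2^-1 ^+ L * maxnorm v.
    by rewrite mulr_ge0 ?maxnorm_ge0 // mulr_ge0 ?(ltW al0) // exprn_ge0.
  by rewrite mulrBl; lra.
elim: L KL => [|L IH]; first by rewrite leqn0 => /eqP ->; rewrite subrr mul0r addr0.
rewrite leq_eqVlt => /predU1P[->|]; first by rewrite subrr mul0r addr0.
rewrite ltnS => /IH; rewrite /grad big_ord_recr /=.
have : w L * - maxnorm v <= w L * ls L v.
  rewrite ler_pM2l //; have := lsN L (- v); rewrite (linear_formN _ (lls L)) maxnormN.
  lra.
by rewrite /w exprSr; lra.
Qed.

Lemma asplund_separator : Asplund X -> exists u P,
  [/\ forall i, Omega i (u i), maxnorm (u - (fun=> xbar)) <= r &
      separator Omega a al u P].
Proof.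
move=> aX.
(* The starting point and the shifts must lie in Y, so that the gap vectors of points of Y do
   too. *)
pose base := xbar :: [seq a i | i <- enum 'I_m].
have [c [sY Yb red]] := separator_reduction Omega a al0 al1 base.
set Y := seq_closure c in sY Yb red.
have Yx : Y xbar by apply: Yb; rewrite mem_head.
have Ya i : Y (a i) by apply: Yb; rewrite in_cons map_f ?orbT // mem_enum.
(* The bound al rho makes the smoothing error at most al times the gap at u. *)
pose kappa := Num.min (al * rho) (al * r / 32).
have k0 : 0 < kappa by rewrite lt_min !(mulr_gt0, divr_gt0).
have [h0 [h0_ge h0_le h0_lip h0_diff]] := smooth_maxnorm aX sY m k0.
have rk0 k : 0 < r * 2^-1 ^+ k.+2 by rewrite mulr_gt0 // exprn_gt0.
have [H HP] := choice (fun k => smooth_maxnorm aX sY m.+1 (rk0 k)).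
pose S := [set z : 'I_m.+1 -> X | forall i, (Omega i `&` Y) (z i)].
pose J u := h0 (gaps a u).
have cF i : closed (Omega i `&` Y).
  apply: closedI; first exact: Omega_closed.
  by rewrite /Y seq_closureE; exact: closed_closure.
have [||||||||zs [u [Szs Su Nu umin]]] := @variational_principle _ _
    (fun z : 'I_m.+1 -> X => maxnorm z) S (sublinear_maxnorm X m.+1) (@maxnormN _ _ m.+1)
    _ J 2 al r H (fun=> xbar) _ _ al0 r0 _ _ _ _ _.
- by move=> v Sv cv; exact: (complete_box cF Sv cv).
- by [].
- move=> x z; apply: le_trans (h0_lip _ _) _.
  by rewrite gapsB maxnormN; exact: maxnorm_diffs.
- by move=> k z; case: (HP k).
- by move=> k z; case: (HP k).
- by move=> k x z; case: (HP k).
- by move=> i.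
- move=> z _; rewrite /J; have -> : gaps a (fun=> xbar) = a.
    by apply/funext => i; rewrite /gaps subrr add0r.
  have := h0_le a; have := h0_ge (gaps a z); have := maxnorm_ge0 (gaps a z).
  have : kappa <= al * r / 32 by rewrite /kappa ge_min lexx orbT.
  by move: a_le; lra.
have Ou i : Omega i (u i) by case: (Su i).
have Yu i : Y (u i) by case: (Su i).
have Ygaps i : Y (gaps a u i).
  exact: (linear_subspaceD sY (linear_subspaceB sY (Yu _) (Yu _)) (Ya i)).
have [l [ll lN h0l l_diff]] := h0_diff _ Ygaps.
have ls_ex k : exists l, [/\ linear_form l, forall z, l z <= maxnorm z &
    forall e, 0 < e -> exists2 r, 0 < r & forall v, (forall i, Y (v i)) ->
      maxnorm v < r -> H k (u - zs k + v) <= H k (u - zs k) + l v + e * maxnorm v].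
  have [_ _ _ Hd] := HP k; have [i|l' [? ? _ ?]] := Hd (u - zs k); last by exists l'.
  exact: (linear_subspaceB sY (Yu i) (Szs k i).2).
have [ls lsP] := choice ls_ex.
have lls k : linear_form (ls k) by case: (lsP k).
have lsN k z : ls k z <= maxnorm z by case: (lsP k).
have lin_grad K : linear_form (grad l ls K).
  split=> [x z|b x]; rewrite /grad.
    rewrite diffsD ll.1 addrBD; congr (_ - _); rewrite -big_split.
    by apply: eq_bigr => j _; rewrite (lls j).1 mulrDr.
  rewrite diffsZ ll.2 mulrBr; congr (_ - _); rewrite mulr_sumr.
  by apply: eq_bigr => j _; rewrite (lls j).2 mulrCA.
have grad_le K v : grad l ls K v <= l (diffs v) + al * maxnorm v.
  have := grad_diff l v lls lsN (leq0n K).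
  by rewrite /grad big_ord0 subr0 expr0 mulr1.
(* The form l contributes [maxnorm (diffs v)] and the perturbations at most al |v|, together at most
   [fuzzy_norm v]. At the gap vector, smoothing and perturbations each cost at most al M. *)
have quasi K : quasi_separator a al u (grad l ls K).
  split=> // [v|].
    apply: le_trans (grad_le K v) _; rewrite /fuzzy_norm.
    have := lN (diffs v).
    have : al * maxnorm v <= al * (`|v ord_max| + maxnorm (diffs v)).
      by rewrite ler_pM2l // maxnorm_le_diffs.
    lra.
  have := grad_le K (- extend0 (gaps a u)).
  rewrite (linear_formN _ (lin_grad K)) diffsN (linear_formN _ ll) maxnormN.
  rewrite diffs_extend0.
  have := h0_ge (gaps a u); have := gaps_ge Ou.
  have : kappa <= al * rho by rewrite /kappa ge_min lexx.
  set M := maxnorm (gaps a u) => h1 h2 h3 h4.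
  have h5 : al * maxnorm (extend0 (gaps a u)) <= al * M.
    by rewrite ler_pM2l // maxnorm_extend0.
  have h6 : al * rho <= al * M by rewrite ler_pM2l.
  lra.
have normal K e : 0 < e -> exists2 d : R, 0 < d & forall i x, Omega i x -> Y x ->
    `|x - u i| < d ->
    grad l ls K (single i (x - u i)) <= (e + al * 2^-1 ^+ K) * `|x - u i|.
  move=> e0; have e2 : 0 < e / 2 by rewrite divr_gt0.
  have e4 : 0 < e / 4 by rewrite divr_gt0.
  have [r1 r10 H1] := l_diff _ e4.
  have [r2 r20 H2] := sum_Frechet (W := [set v | forall i, Y (v i)])
    (@maxnorm_ge0 _ _ m.+1) (fun j => ltW (w0 j))
    (fun j => let: And3 _ _ D := lsP j in D) K e2.
  exists (Num.min (r1 / 2) r2); first by rewrite lt_min divr_gt0.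
  move=> i x Ox Yxx; rewrite lt_min => /andP[xr1 xr2].
  set k := single i (x - u i).
  have kN : maxnorm k <= `|x - u i| by exact: maxnorm_single.
  have Yk j : Y (k j).
    rewrite /k /single; case: eqP => _; last exact: sY.1.
    exact: (linear_subspaceB sY Yxx (Yu i)).
  have Yd j : Y ((- diffs k) j).
    exact: (linear_subspaceN sY (linear_subspaceB sY (Yk _) (Yk _))).
  have Suk : S (u + k).
    move=> j; rewrite -[(u + k) j]/(u j + k j) /k /single.
    by case: eqP => [->|_]; [rewrite addrC subrK|rewrite addr0].
  have dN : maxnorm (- diffs k) <= 2 * maxnorm k by rewrite maxnormN maxnorm_diffs.
  (* Minimality at u and the upper derivative estimates bound [grad], which is minus the derivative
     of the smoothed function. *)
  have := umin K _ Suk; rewrite /J gaps_add => h1.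
  have h3 := H2 _ Yk (le_lt_trans kN xr2).
  have h4 : maxnorm (- diffs k) < r1 by move: xr1; rewrite ltr_pdivlMr //; lra.
  have {}h2 := H1 _ Yd h4; rewrite (linear_formN _ ll) in h2.
  have e1 : u + k - u = k by rewrite addrAC subrr add0r.
  have e3 : \sum_(j < K) al * 2^-1 ^+ j.+1 * H j (u + k - zs j) =
      \sum_(j < K) w j * H j (u - zs j + k).
    by apply: eq_bigr => j _; rewrite addrAC.
  rewrite e1 e3 in h1.
  have h5 : e / 4 * maxnorm (- diffs k) <= e / 4 * (2 * maxnorm k) by rewrite ler_pM2l.
  apply: (@le_trans _ _ ((e + al * 2^-1 ^+ K) * maxnorm k)); last first.
    by rewrite ler_wpM2l // addr_ge0 ?(ltW e0) // mulr_ge0 ?(ltW al0) // exprn_ge0.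
  by rewrite /grad mulrDl; move: h1 h2 h3 h5; rewrite /w; lra.
(* For each accuracy, a number of perturbation terms and a radius; a quarter of the accuracy goes to
   the derivative and a quarter to the tail of the series. *)
have Kd_ex (j : nat) : exists p : nat * nat,
    2^-1 ^+ p.1 <= j.+1%:R^-1 / 4 :> R /\
    forall i x, Omega i x -> Y x -> `|x - u i| < p.2.+1%:R^-1 ->
    grad l ls p.1 (single i (x - u i)) <=
      (j.+1%:R^-1 / 4 + al * 2^-1 ^+ p.1) * `|x - u i|.
  have e4 : 0 < j.+1%:R^-1 / 4 :> R by rewrite divr_gt0.
  have [K HK] := expr_half_small e4; have [d d0 Hd] := normal K _ e4.
  have [n nd] := invS_lt d0; exists (K, n); split=> [|i x Ox Yxx xn].
    exact/ltW/HK.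
  by apply: Hd => //; exact: lt_trans nd.
have [Kd KdP] := choice Kd_ex.
have [J'|P sP] := red u (fun j => (Kd j).2) Yu; last by exists u, P.
(* One partial gradient long enough for all accuracies below J'; passing to it costs each of them
   another quarter at most. *)
pose K := (\max_(j < J') (Kd j).1)%N; exists (grad l ls K); split=> //.
move=> j i x jJ Ox Yxx xd.
have [hK hg] := KdP j; have {}hg := hg i x Ox Yxx xd.
have jK : ((Kd j).1 <= K)%N.
  exact: (@leq_bigmax _ (fun j : 'I_J' => (Kd j).1) (Ordinal jJ)).
apply: le_trans (grad_diff l _ lls lsN jK) _.
have e0 : 0 < j.+1%:R^-1 :> R by rewrite invr_gt0.
move: e0 hK hg; set e : R := _^-1; set p : R := 2^-1 ^+ _ => e0 hK hg.
have ap : al * p <= e / 4.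
  by rewrite -[leRHS]mul1r; apply: ler_pM => //; rewrite ?exprn_ge0 // ltW.
have h1 : al * p * maxnorm (single i (x - u i)) <= e / 4 * `|x - u i|.
  apply: ler_pM => //; [|exact: maxnorm_ge0|exact: maxnorm_single].
  by rewrite mulr_ge0 ?(ltW al0) // exprn_ge0.
have h2 : (e / 4 + al * p) * `|x - u i| <= (e / 2) * `|x - u i|.
  by rewrite ler_wpM2r //; lra.
have h3 : 0 <= e * `|x - u i| by rewrite mulr_ge0 // ltW.
lra.
Qed.

End AsplundSeparation.

(** * Normalization *)

Section DualNorm.
Variables (R : realType) (X : normedModType R).
Implicit Types f g : X -> R^o.

Lemma dual_norm_ge0 f : 0 <= dual_norm f.
Proof.
rewrite /dual_norm; set S := [set _ | _ in _].
(* For an unbounded functional, [sup] takes its default value 0. *)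
have [sS|/sup_out -> //] := pselect (has_sup S).
have S0 : S `|f 0| by exists 0; rewrite //= normr0.
exact: le_trans (normr_ge0 _) (ub_le_sup sS.2 S0).
Qed.

Lemma dual_norm_le f (C : R) :
  0 <= C -> (forall x, `|f x| <= C * `|x|) -> dual_norm f <= C.
Proof.
move=> C0 H; apply: ge_sup; first by exists `|f 0|, 0; rewrite //= normr0.
move=> _ [x /= x1 <-]; apply: le_trans (H x) _.
by rewrite -[leRHS]mulr1 ler_wpM2l.
Qed.

Lemma dual_norm_ge f (C : R) x : (forall x, `|f x| <= C * `|x|) ->
  0 <= C -> `|x| <= 1 -> `|f x| <= dual_norm f.
Proof.
move=> H C0 x1; apply: ub_le_sup; last by exists x.
exists C => _ [z /= z1 <-]; apply: le_trans (H z) _.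
by rewrite -[leRHS]mulr1 ler_wpM2l.
Qed.

Lemma dual_norm_bound f (C : R) x : linear_form f -> 0 <= C ->
  (forall x, `|f x| <= C * `|x|) -> `|f x| <= dual_norm f * `|x|.
Proof.
move=> lf C0 H; have [->|x0] := eqVneq x 0.
  by rewrite (linear_form0 lf) !normr0 mulr0.
have nx : 0 < `|x| by rewrite normr_gt0.
have := @dual_norm_ge f C (`|x|^-1 *: x) H C0.
rewrite normrZ normfV normr_id mulVf ?gt_eqF // lexx => /(_ isT).
by rewrite lf.2 normrM normfV normr_id ler_pdivrMl // mulrC.
Qed.

Lemma dual_normZ (c : R) f : 0 < c -> dual_norm (c *: f) = c * dual_norm f.
Proof.
move=> c0; rewrite /dual_norm.
have -> : [set `|(c *: f) x| | x in [set x : X | `|x| <= 1]] =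
    [set c * y | y in [set `|f x| | x in [set x : X | `|x| <= 1]]].
  rewrite image_comp; apply: eq_imagel => x _ /=.
  by rewrite -[(c *: f) x]/(c * f x) normrM gtr0_norm.
set S := [set `|f x| | x in _].
have S0 : S !=set0 by exists `|f 0|, 0; rewrite //= normr0.
have [ubS|nub] := pselect (has_ubound S); last first.
  rewrite !sup_out ?mulr0 //; first by move=> [].
  move=> [_ [M HM]]; apply: nub; exists (c^-1 * M) => y Sy.
  by rewrite ler_pdivlMl //; apply: HM; exists y.
apply/le_anti/andP; split.
  apply: ge_sup; first by have [y Sy] := S0; exists (c * y), y.
  by move=> _ [y Sy <-]; rewrite ler_pM2l //; exact: ub_le_sup.
rewrite -ler_pdivlMl //; apply: ge_sup => // y Sy.
rewrite ler_pdivlMl //; apply: ub_le_sup; last by exists y.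
have [M HM] := ubS; exists (c * M) => _ [z Sz <-].
by rewrite ler_pM2l //; exact: HM.
Qed.

Lemma dual_dist_le (N : set (X -> R^o)) f g : N g -> dual_dist N f <= dual_norm (f - g).
Proof.
move=> Ng; apply: ge_inf; last by exists g.
by exists 0 => _ [h _ <-]; exact: dual_norm_ge0.
Qed.

Lemma linear_form_dual_space f (C : R) : linear_form f -> 0 <= C ->
  (forall x, `|f x| <= C * `|x|) -> dual_space f.
Proof.
move=> lf C0 H; split; first by move=> b x y; rewrite lf.1 lf.2.
have C1 : 0 < C + 1 by rewrite ltr_wpDl.
move=> x; apply/cvgrPdist_lt => e e0; near=> y.
rewrite -(linear_formB _ _ lf); apply: le_lt_trans (H _) _.
apply: (@le_lt_trans _ _ ((C + 1) * `|x - y|)).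
  by rewrite ler_wpM2r // lerDl.
rewrite -ltr_pdivlMl //; near: y; apply: cvgr_dist_lt => //.
by rewrite mulr_gt0 // invr_gt0.
Unshelve. all: by end_near. Qed.

Lemma Frechet_normal_coneP (Omega : set X) (xbar : X) f : dual_space f ->
  (forall e : R, 0 < e -> exists2 d : R, 0 < d & forall w, Omega w ->
    `|w - xbar| < d -> f (w - xbar) <= e * `|w - xbar|) ->
  Frechet_normal_cone Omega xbar f.
Proof.
move=> df H; split=> //; apply/lee_addgt0Pr => e e0; rewrite add0e.
have [d d0 Hd] := H e e0.
pose B := (Omega `\ xbar) `&` ball xbar d.
apply: (@le_trans _ _ (ereal_sup
    [set (f (x - xbar) / `|x - xbar|)%:E | x in B])).
  apply: ereal_inf_lbound; exists B => //.
  rewrite /within /=; near=> x => Ox; split=> //.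
  by near: x; exact: nbhsx_ballx.
apply: ge_ereal_sup => _ [x [[Ox /eqP xx] xd] <-]; rewrite lee_fin.
have nx : 0 < `|x - xbar| by rewrite normr_gt0 subr_eq0.
rewrite ler_pdivrMr //; apply: Hd => //.
by rewrite -ball_normE /= in xd; rewrite distrC.
Unshelve. all: by end_near. Qed.

(** The norm dual to the maximum norm is the sum of the dual norms: unit vectors that nearly norm
    each component, with signs adjusted, are assembled into one tuple. *)
Lemma sum_dual_norm_le n (p : 'I_n -> X -> R^o) (C : R) : 0 <= C ->
  (forall i, linear_form (p i)) ->
  (forall z : 'I_n -> X, \sum_i p i (z i) <= C * maxnorm z) ->
  \sum_i dual_norm (p i) <= C.
Proof.
move=> C0 lp pC; apply/ler_addgt0Pl => e e0.
have n1 : 0 < n.+1%:R :> R by [].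
have en : 0 < e / n.+1%:R by rewrite divr_gt0.
have near_sup i : exists x : X, `|x| <= 1 /\ dual_norm (p i) - e / n.+1%:R < p i x.
  have [||_ [x /= x1 <-] Hx] := @sup_gt _ [set `|p i x| | x in [set x : X | `|x| <= 1]]
     (dual_norm (p i) - e / n.+1%:R).
    by exists `|p i 0|, 0; rewrite //= normr0.
    by rewrite ltrBlDr ltrDl.
  have [px|px] := leP 0 (p i x).
    by exists x; split=> //; rewrite -[ltRHS]ger0_norm.
  exists (- x); rewrite normrN; split=> //.
  by rewrite (linear_formN _ (lp i)) -[ltRHS]ltr0_norm.
have [z zP] := choice near_sup.
have z1 : maxnorm z <= 1 by apply: maxnorm_le => // i; case: (zP i).
have : \sum_i (dual_norm (p i) - e / n.+1%:R) <= C.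
  apply: (@le_trans _ _ (C * maxnorm z)); last by rewrite -[leRHS]mulr1 ler_wpM2l.
  apply: le_trans (pC z); apply: ler_sum => i _; apply: ltW.
  by case: (zP i).
rewrite sumrB lerBlDr => /le_trans; apply; rewrite addrC lerD2r.
rewrite sumr_const card_ord -[leLHS]mulr_natl mulrCA ler_piMr ?(ltW e0) //.
by rewrite ler_pdivrMr // mul1r ler_nat.
Qed.

End DualNorm.

Section Assembly.
Variables (R : realType) (X : normedModType R) (m : nat).
Variables (Omega : 'I_m.+1 -> set X) (a : 'I_m -> X) (xbar : X).
Variables (al eps tau : R).
Hypotheses (al0 : 0 < al) (al1 : al < 1).
Hypotheses (al_eps : 8 * al <= eps) (al_tau : 8 * al <= 1 - tau) (al8 : 8 * al <= 1).
Hypothesis tau0 : 0 < tau.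

(** The first n - 1 components of P, divided by the sum s of their norms, are exact normals. The
    last functional is minus their sum, and its distance to the normal P_n / s is at most the norm
    of the sum of all components over s. *)
Lemma fuzzy_separation_of_separator u P : separator Omega a al u P ->
  0 < maxnorm (gaps a u) -> (forall i, Omega i (u i) /\ ball xbar eps (u i)) ->
  exists xs, fuzzy_separation Omega xbar eps u xs /\
    tau * maxnorm (gaps a u) < \sum_(i < m) xs (below i) (gaps a u i).
Proof.
move=> [[lP Pq Pgap] Pn] M0 uO; set M := maxnorm (gaps a u) in M0 Pgap *.
pose p i : X -> R^o := fun x => P (single i x).
have lp i : linear_form (p i).
  by split=> [x z|b x]; rewrite /p (singleD, singleZ) (lP.1, lP.2).
have pb i x : `|p i x| <= 5 * `|x|.
  have H z : p i z <= 5 * `|z|.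
    apply: le_trans (Pq _) _; apply: le_trans (fuzzy_norm_le al0 al1 _) _.
    by rewrite ler_pM2l // maxnorm_single.
  rewrite ler_norml H andbT; have := H (- x).
  by rewrite (linear_formN _ (lp i)) normrN; lra.
pose s := \sum_(i < m) dual_norm (p (below i)).
have ext_sum g : P (extend0 g) = \sum_(i < m) p (below i) (g i).
  rewrite (linear_form_sum _ lP) big_ord_recr /=.
  rewrite extend0_max -[X in single _ X](scale0r 0) singleZ scale0r.
  rewrite (linear_form0 lP) addr0; apply: eq_bigr => i _.
  by rewrite -/(below i) extend0_below.
have sle : s <= 1 + al.
  apply: sum_dual_norm_le => //; first by rewrite addr_ge0 // ltW.
  move=> z; rewrite -ext_sum; apply: le_trans (Pq _) _.
  by rewrite /fuzzy_norm extend0_max normr0 mulr0 add0r diffs_extend0.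
have sge : 1 - 2 * al <= s.
  rewrite -(ler_pM2r M0); apply: le_trans Pgap _.
  rewrite ext_sum /s mulr_suml; apply: ler_sum => i _.
  apply: le_trans (ler_norm _) _.
  apply: le_trans (dual_norm_bound _ (lp _) (ler0n R 5) (pb _)) _.
  by rewrite ler_wpM2l ?dual_norm_ge0 // le_maxnorm.
have s0 : 0 < s by move: al8; lra.
have si0 : 0 < s^-1 by rewrite invr_gt0.
pose xs j : X -> R^o := if unlift ord_max j is Some i then s^-1 *: p (below i)
  else - \sum_(i < m) s^-1 *: p (below i).
have xsb i : xs (below i) = s^-1 *: p (below i).
  by rewrite /xs {1}below_lift liftK.
have xsm : xs ord_max = - \sum_(i < m) s^-1 *: p (below i) by rewrite /xs unlift_none.
have dsZ i : dual_space (s^-1 *: p i).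
  apply: (@linear_form_dual_space _ _ _ (s^-1 * 5)).
  - split=> [x z|b x]; rewrite -![(s^-1 *: p i) _]/(s^-1 * p i _).
      by rewrite (lp i).1 mulrDr.
    by rewrite (lp i).2 mulrCA.
  - by rewrite mulr_ge0 // ltW.
  - move=> x; rewrite -[(s^-1 *: p i) x]/(s^-1 * p i x) normrM gtr0_norm //.
    by rewrite -mulrA ler_pM2l.
have cone_p i : Frechet_normal_cone (Omega i) (u i) (s^-1 *: p i).
  apply: Frechet_normal_coneP => // e e0.
  have [d d0 Hd] := Pn i _ (mulr_gt0 s0 e0); exists d => // w Ow wd.
  rewrite -[(s^-1 *: p i) _]/(s^-1 * p i _) ler_pdivrMl // mulrA.
  exact: Hd.
exists xs; split; last first.
  have -> : \sum_(i < m) xs (below i) (gaps a u i) = s^-1 * P (extend0 (gaps a u)).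
    rewrite ext_sum mulr_sumr; apply: eq_bigr => i _; by rewrite xsb.
  rewrite ltr_pdivlMl //; apply: lt_le_trans Pgap.
  rewrite mulrA ltr_pM2r //.
  (* Since tau <= 1 - 8 al, the product (1 + al) tau stays below 1 - 2 al. *)
  have h1 : s * tau <= (1 + al) * tau by rewrite ler_pM2r.
  have h2 : (1 + al) * tau <= (1 + al) * (1 - 8 * al).
    by rewrite ler_pM2l ?addr_gt0 //; move: al_tau; lra.
  have h3 : 0 < al * al by rewrite mulr_gt0.
  lra.
split=> //.
- apply: ord_maxP => [|i]; last by rewrite xsb.
  rewrite xsm; have sm0 : 0 <= \sum_(i < m) s^-1 * 5.
    by apply: sumr_ge0 => i _; rewrite mulr_ge0 // ltW.
  have smE x : (- \sum_(i < m) s^-1 *: p (below i)) x =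
      - \sum_(i < m) s^-1 * p (below i) x.
    by rewrite -[LHS]/(- ((\sum_(i < m) s^-1 *: p (below i)) x)) fct_sumE.
  apply: (linear_form_dual_space _ sm0).
    split=> [x z|b x]; rewrite !smE.
      rewrite -opprD -big_split /=; congr (- _); apply: eq_bigr => i _.
      by rewrite (lp _).1 mulrDr.
    rewrite mulrN mulr_sumr; congr (- _); apply: eq_bigr => i _.
    by rewrite (lp _).2 mulrCA.
  move=> x; rewrite smE normrN; apply: le_trans (ler_norm_sum _ _ _) _.
  rewrite mulr_suml; apply: ler_sum => i _; rewrite normrM gtr0_norm //.
  by rewrite -mulrA ler_pM2l.
- rewrite big_ord_recr /=.
  have h1 : \sum_(i < m) dual_dist
      (Frechet_normal_cone (Omega (widen_ord (leqnSn m) i))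
        (u (widen_ord (leqnSn m) i)))
      (xs (widen_ord (leqnSn m) i)) <= 0.
    apply: sumr_le0 => i _; rewrite -/(below i) xsb.
    apply: le_trans (dual_dist_le _ (cone_p (below i))) _.
    rewrite subrr; apply: dual_norm_le => // x.
    by rewrite -[(0 : X -> R^o) x]/(0 : R) normr0 mul0r.
  have h2 : dual_dist (Frechet_normal_cone (Omega ord_max) (u ord_max)) (xs ord_max)
      <= s^-1 * al.
    apply: le_trans (dual_dist_le _ (cone_p ord_max)) _.
    apply: dual_norm_le => [|x]; first by rewrite mulr_ge0 // ltW.
    (* The difference is minus the sum of all components, that is P on constant tuples, where
       [diffs] vanishes and only the al term of [fuzzy_norm] remains. *)
    have -> : (xs ord_max - s^-1 *: p ord_max) x = - (s^-1 * P (fun=> x)).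
      rewrite xsm (linear_form_sum _ lP) big_ord_recr /= mulrDr mulr_sumr opprD.
      rewrite -[LHS]/(- (\sum_(i < m) s^-1 *: p (below i)) x -
        s^-1 * p ord_max x).
      by rewrite fct_sumE.
    rewrite normrN normrM gtr0_norm // -mulrA ler_pM2l //.
    have H z : P (fun=> z) <= al * `|z|.
      apply: le_trans (Pq _) _; rewrite /fuzzy_norm.
      have -> : diffs (fun=> z) = 0 :> ('I_m -> X).
        by apply/funext => i; rewrite /diffs subrr.
      by rewrite (sublinear0 (sublinear_maxnorm X m)) mulr0 addr0.
    rewrite ler_norml H andbT; have := H (- x).
    rewrite (_ : (fun=> - x) = - (fun=> x)) // (linear_formN _ lP) normrN; lra.
  have h3 : s^-1 * al < eps.
    rewrite ltr_pdivrMl //; have : 3 / 4 * eps <= s * eps.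
      by rewrite ler_pM2r; [move: al8; lra|move: al_eps al0; lra].
    by move: al_eps al0; lra.
  lra.
- by rewrite big_ord_recr /= xsm (eq_bigr _ (fun i _ => xsb i)) subrr.
- rewrite (eq_bigr (fun i => s^-1 * dual_norm (p (below i)))).
    by rewrite -mulr_sumr mulVf ?gt_eqF.
  by move=> i _; rewrite xsb dual_normZ.
Qed.

End Assembly.

(** * Existence of separators and conclusion *)

Lemma exists_separator (R : realType) (X : completeNormedModType R) (m : nat)
    (Omega : 'I_m.+1 -> set X) (a : 'I_m -> X) (al r rho : R) (xbar : X) :
  0 < al -> al < 1 -> 0 < r -> 0 < rho ->
  (forall i, closed (Omega i)) -> (forall i, Omega i xbar) ->
  (Asplund X \/ forall i, convex_set (Omega i : set (convex_lmodType X))) ->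
  (forall z, (forall i, Omega i (z i)) -> rho <= maxnorm (gaps a z)) ->
  maxnorm a <= al * r / 32 ->
  exists u P, [/\ forall i, Omega i (u i), maxnorm (u - (fun=> xbar)) <= r &
    separator Omega a al u P].
Proof.
move=> al0 al1 r0 rho0 cO Ox [aX|cvO] rho_le a_le.
  exact: asplund_separator rho0 _ _ _ _ _.
pose S := [set z : 'I_m.+1 -> X | forall i, Omega i (z i)].
have [||||||||zs [u [_ Su Nu umin]]] := @variational_principle _ _
    (fun z : 'I_m.+1 -> X => maxnorm z) S (sublinear_maxnorm X m.+1)
    (@maxnormN _ _ m.+1) _ (fun u => maxnorm (gaps a u)) 2 al r
    (fun _ z => maxnorm z) (fun=> xbar) _ _ al0 r0 _ _ _ _ _.
- by move=> v Sv cv; exact: (complete_box cO Sv cv).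
- by [].
- by move=> x z; exact: maxnorm_gaps_lip.
- by move=> k z; rewrite gerBl mulr_ge0 ?(ltW r0) // exprn_ge0.
- by [].
- move=> _ x z; have := (sublinear_maxnorm X m.+1).1 (x - z) z.
  by rewrite subrK /=; lra.
- by [].
- move=> z _; have -> : gaps a (fun=> xbar) = a.
    by apply/funext => i; rewrite /gaps subrr add0r.
  have := maxnorm_ge0 (gaps a z); have := mulr_gt0 al0 r0; move: a_le; lra.
have [|P sP] := convex_separator (a := a) al0 cvO Su; last by exists u, P.
by move=> z Oz; have := umin 0%N z Oz; rewrite !big_ord0 !addr0 expr0 mulr1.
Qed.

Theorem corollary5p5 (R : realType) (X : completeNormedModType R)
    (m : nat) (hm : (0 < m)%N)
    (Omega : 'I_m.+1 -> set X) (xbar : X)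
    (Omega_closed : forall i, closed (Omega i))
    (Omega_xbar : forall i, Omega i xbar)
    (hX : Asplund X \/
          forall i, convex_set (Omega i : set (convex_lmodType X)))
    (hext : extremal (FA X m) Omega xbar) :
  (forall eps : R, 0 < eps ->
     exists (x : 'I_m.+1 -> X) (xs : 'I_m.+1 -> X -> R^o),
       fuzzy_separation Omega xbar eps x xs) /\
  (forall eps tau : R, 0 < eps -> 0 < tau -> tau < 1 ->
     exists (x : 'I_m.+1 -> X) (xs : 'I_m.+1 -> X -> R^o),
       fuzzy_separation Omega xbar eps x xs /\
       exists a : 'I_m -> X,
         [/\ maxnorm a < eps,
             exists2 rho : R, 0 < rho &
               (\bigcap_(i in [set: 'I_m])
                   [set u - a i | u in enlarge (Omega (below i)) rho])
               `&` enlarge (Omega ord_max) rho = set0 &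
             \sum_(i < m) xs (below i) (x ord_max - x (below i) + a i)
             > tau * maxnorm (fun i => x ord_max - x (below i) + a i)]).
Proof.
have main (eps tau : R) : 0 < eps -> 0 < tau -> tau < 1 ->
     exists (x : 'I_m.+1 -> X) (xs : 'I_m.+1 -> X -> R^o),
       fuzzy_separation Omega xbar eps x xs /\
       exists a : 'I_m -> X,
         [/\ maxnorm a < eps,
             exists2 rho : R, 0 < rho &
               (\bigcap_(i in [set: 'I_m])
                   [set u - a i | u in enlarge (Omega (below i)) rho])
               `&` enlarge (Omega ord_max) rho = set0 &
             \sum_(i < m) xs (below i) (x ord_max - x (below i) + a i)
             > tau * maxnorm (fun i => x ord_max - x (below i) + a i)].
  move=> eps0 tau0 tau1.
  pose al := Num.min (Num.min eps (1 - tau)) 1 / 8.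
  have al0 : 0 < al by rewrite divr_gt0 // !lt_min eps0 subr_gt0 tau1 ltr01.
  have al_le : 8 * al <= Num.min (Num.min eps (1 - tau)) 1.
    by rewrite mulrC mulfVK.
  move: al_le; rewrite !le_min => /andP[/andP[al_eps al_tau] al8].
  have al1 : al < 1 by lra.
  (* The variational principle gives distance at most r, while the balls are open of radius eps. *)
  pose r := eps / 2; have r0 : 0 < r by rewrite divr_gt0.
  have e0 : 0 < Num.min (al * r / 32) eps.
    by rewrite lt_min eps0 divr_gt0 // mulr_gt0.
  have [_ [rho [[a _ <-] rho0 aeps disj]]] := hext _ e0.
  have {aeps}a_lt : maxnorm a < Num.min (al * r / 32) eps.
    move: aeps; rewrite lte_fin; congr (_ < _).
    rewrite -[RHS]maxnormN; congr maxnorm; apply/funext => i.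
    by rewrite below_eq_max sub0r.
  move: a_lt; rewrite lt_min => /andP[a_lt a_eps].
  have sub_enlarge i x : Omega i x -> enlarge (Omega i) rho x.
    move=> Ox; exists x => //; exists 0; first exact: ballxx.
    by rewrite scaler0 addr0.
  have no_common (x : 'I_m.+1 -> X) : (forall i, enlarge (Omega i) rho (x i)) ->
      ~ (forall i, x (below i) = x ord_max + a i).
    move=> /disj; rewrite lte_fin => /bigmax_gtP[|[i _]]; first by rewrite ltxx.
    rewrite below_eq_max => + H.
    by rewrite H [x ord_max + _]addrC addrK subrr normr0 ltxx.
  have rho_le z : (forall i, Omega i (z i)) -> rho <= maxnorm (gaps a z).
    (* If all gaps were shorter than rho, each point z_n + a_i would lie in the rho-enlargement of
       Omega_i, against extremality. *)
    move=> Oz; rewrite leNgt; apply/negP => lt_rho.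
    pose x j := if unlift ord_max j is Some i then z ord_max + a i else z j.
    have xb i : x (below i) = z ord_max + a i by rewrite /x below_lift liftK.
    have xm : x ord_max = z ord_max by rewrite /x unlift_none.
    apply: (no_common x); last by move=> i; rewrite xb xm.
    apply: ord_maxP => [|i]; first by rewrite xm; exact: sub_enlarge.
    rewrite xb; exists (z (below i)) => //; exists (rho^-1 *: gaps a z i).
      rewrite -ball_normE /= sub0r normrN normrZ gtr0_norm ?invr_gt0 //.
      by rewrite mulrC ltr_pdivrMr // mul1r (le_lt_trans _ lt_rho) // le_maxnorm.
    rewrite scalerA mulfV ?gt_eqF // scale1r /gaps [LHS]addrA.
    by rewrite [z (below i) + _]addrC subrK.
  have [u [P [Ou ur sP]]] := exists_separator al0 al1 r0 rho0 Omega_closed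
    Omega_xbar hX rho_le (ltW a_lt).
  have uball i : Omega i (u i) /\ ball xbar eps (u i).
    split=> //; rewrite -ball_normE /= distrC.
    apply: le_lt_trans (le_maxnorm (u - (fun=> xbar)) i) _.
    by apply: le_lt_trans ur _; rewrite /r; lra.
  have M0 := lt_le_trans rho0 (rho_le u Ou).
  have [xs [fs gt]] := fuzzy_separation_of_separator al0 al1 al_eps al_tau al8
    tau0 sP M0 uball.
  exists u, xs; split=> //; exists a; split=> //; exists rho => //.
  apply/seteqP; split=> // v [/= Hv Hvm].
  pose x j := if unlift ord_max j is Some i then v + a i else v.
  have xb i : x (below i) = v + a i by rewrite /x below_lift liftK.
  have xm : x ord_max = v by rewrite /x unlift_none.
  apply: (no_common x); last by move=> i; rewrite xb xm.
  apply: ord_maxP => [|i]; first by rewrite xm.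
  by have [w Hw wv] := Hv i I; rewrite xb -wv subrK.
split=> // eps eps0.
(* Any tau in (0, 1) serves for the first claim. *)
have half0 : 0 < 2^-1 :> R by rewrite invr_gt0.
have half1 : 2^-1 < 1 :> R by rewrite invf_lt1 // ltr1n.
by have [x [xs [fs _]]] := main eps 2^-1 eps0 half0 half1; exists x, xs.
Qed.
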